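(* Let $V$ be a complex vector space of dimension $d+2$ and let $\mathcal{S}$ be the universal rank $2$ subbundle on the Grassmannian $\mathbf{G}=\mathrm{Gr}(2,V)$. Then there are isomorphisms $$\Lambda^{2}S^{3}\mathcal{S} \cong \Sigma^{(5,1)}\mathcal{S}\oplus\Sigma^{(3,3)}\mathcal{S},\qquad \Lambda^{3}S^{3}\mathcal{S}\cong\Sigma^{(6,3)}\mathcal{S},\qquad \Lambda^{4}S^{3}\mathcal{S}\cong\Sigma^{(6,6)}\mathcal{S}.$$
   Context: $\mathrm{Gr}(2,V)$ parametrises two-dimensional subspaces of $V$, and $\mathcal{S}\subset\mathcal{O}\otimes V$ is the tautological subbundle. $\Sigma^{\lambda}$ denotes the Schur power (Schur functor) corresponding to $\lambda$, normalised so that $\Sigma^{(k)}=S^{k}$ is the symmetric power and $\Sigma^{(1^{k})}=\Lambda^{k}$ is the exterior power. *)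

(* Defs.v *)
From HB Require Import structures.
From mathcomp Require Import all_boot all_fingroup all_algebra.
From mathcomp Require Import mpoly.
From mathcomp Require Import ring.

Set Implicit Arguments.
Unset Strict Implicit.
Unset Printing Implicit Defensive.

Import GRing.Theory.
Local Open Scope ring_scope.

(* Everything is set up over a field K in the language of classical           *)
(* varieties (points, Zariski-open sets, regular functions); this is the      *)
(* usual notion of algebraic variety when K is algebraically closed.          *)

Section Grassmannian.
Variables (K : fieldType) (V : vectType K).

Definition gr2 := {U : {vspace V} | \dim U == 2}.

Local Notation m := (\dim {:V}).

(* All the 2 x 2 minors p_ij (i, j arbitrary, so p_ji = - p_ij) of the        *)
(* coordinates of a basis of x. Another basis rescales all of them by the     *)
(* same nonzero factor, which is invisible to homogeneous polynomials below.  *)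
Definition plucker (x : gr2) : 'M[K]_m :=
  let u := (vbasis (val x))`_0 in let v := (vbasis (val x))`_1 in
  \matrix_(i, j) (coord (vbasis fullv) i u * coord (vbasis fullv) j v
                - coord (vbasis fullv) j u * coord (vbasis fullv) i v).

Definition pl_eval (P : {mpoly K[m * m]}) (x : gr2) : K :=
  P.@[fun k => mxvec (plucker x) 0 k].

Definition zopen (D : gr2 -> Prop) : Prop :=
  forall x, D x -> exists d (Q : {mpoly K[m * m]}),
    [/\ Q \is d.-homog, pl_eval Q x != 0 & forall y, pl_eval Q y != 0 -> D y].

(* Functions and sections on an open set D are represented by total functions *)
(* whose values outside D are irrelevant.                                     *)
Definition regular_on (D : gr2 -> Prop) (f : gr2 -> K) : Prop :=
  forall x, D x -> exists (N : gr2 -> Prop) d (P Q : {mpoly K[m * m]}),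
    [/\ zopen N, N x, P \is d.-homog, Q \is d.-homog &
        forall y, N y -> [/\ D y, pl_eval Q y != 0
                           & f y = pl_eval P y / pl_eval Q y]].

Definition vregular_on (W : vectType K) (D : gr2 -> Prop) (s : gr2 -> W) :=
  forall l : 'Hom(W, K^o), regular_on D (fun x => l (s x)).

(* A vector bundle presented as a subbundle of a trivial bundle vb_amb (x) O: *)
(* a family of subspaces having a regular frame locally around every point.   *)
Record vbundle := VBundle {
  vb_amb : vectType K;
  vb_fib :> gr2 -> {vspace vb_amb};
  vb_loc : forall x0, exists (D : gr2 -> Prop) r (e : 'I_r -> gr2 -> vb_amb),
    [/\ zopen D, D x0, forall i, vregular_on D (e i)
      & forall x, D x -> basis_of (vb_fib x) [tuple e i x | i < r]]
}.

Definition section_on (E : vbundle) (D : gr2 -> Prop) (s : gr2 -> vb_amb E) :=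
  vregular_on D s /\ forall x, D x -> s x \in E x.

(* Only the restriction of vh_map x to the fibre E x is meaningful. *)
Record vbhom (E F : vbundle) := VBHom {
  vh_map :> gr2 -> 'Hom(vb_amb E, vb_amb F);
  vh_fib : forall x v, v \in E x -> vh_map x v \in F x;
  vh_reg : forall D s, zopen D -> section_on (E := E) D s ->
             vregular_on D (fun x => vh_map x (s x))
}.

Definition vb_isomorphic (E F : vbundle) : Prop :=
  exists (f : vbhom E F) (g : vbhom F E),
    (forall x v, v \in E x -> g x (f x v) = v) /\
    (forall x w, w \in F x -> f x (g x w) = w).

End Grassmannian.

Section Tensors.
Variable K : fieldType.

(* The n-th tensor power of W, in coordinates with respect to vbasis {:W}. *)
Definition tens n (W : vectType K) : vectType K :=
  {ffun {ffun 'I_n -> 'I_(\dim {:W})} -> K^o}.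

Definition pure n (W : vectType K) (v : 'I_n -> W) : tens n W :=
  [ffun f : {ffun 'I_n -> 'I_(\dim {:W})} =>
     \prod_i coord (vbasis fullv) (f i) (v i)].

(* U (x) ... (x) U inside W (x) ... (x) W, for a subspace U of W. *)
Definition tens_sub n (W : vectType K) (U : {vspace W}) : {vspace tens n W} :=
  <<[seq pure (fun i => (vbasis U)`_(f i)) | f : {ffun 'I_n -> 'I_(\dim U)}]>>%VS.

(* The group algebra element \sum_s a s . s acting by place permutations:     *)
(* s sends pure v to pure (v \o s^-1).                                        *)
Definition galg_act n (W : vectType K) (a : 'S_n -> K) (t : tens n W) :
    tens n W :=
  [ffun f : {ffun 'I_n -> 'I_(\dim {:W})} =>
     \sum_s a s * (t [ffun i => f (s i)] : K)].

Definition galg_im n (W : vectType K) (a : 'S_n -> K) (U : {vspace W}) :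
    {vspace tens n W} :=
  (linfun (galg_act (W := W) a) @: tens_sub n U)%VS.

(* Boxes of the diagram of la are numbered row after row: box i lies in row   *)
(* reshape_index la i and column reshape_offset la i.                         *)
Definition row_stab (la : seq nat) : {set 'S_(sumn la)} :=
  [set s : 'S_(sumn la) |
     [forall i, reshape_index la (s i) == reshape_index la i]].

Definition col_stab (la : seq nat) : {set 'S_(sumn la)} :=
  [set s : 'S_(sumn la) |
     [forall i, reshape_offset la (s i) == reshape_offset la i]].

(* c_la = (\sum_(p in row_stab) p) (\sum_(q in col_stab) sgn(q) q); the       *)
(* product of group algebra elements is composition "q first", which is       *)
(* (q * p)%g in the library.                                                  *)
Definition young_symmetrizer (la : seq nat) (s : 'S_(sumn la)) : K :=
  \sum_(p in row_stab la) \sum_(q in col_stab la | (q * p)%g == s) (-1) ^+ q.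

Definition symmetrizer n (s : 'S_n) : K := 1.
Definition antisymmetrizer n (s : 'S_n) : K := (-1) ^+ s.

End Tensors.
Arguments young_symmetrizer {K} la s.
Arguments symmetrizer {K n} s.
Arguments antisymmetrizer {K n} s.

Section Regular.
Variables (K : fieldType) (V : vectType K).
Implicit Types (D N : gr2 V -> Prop) (f g : gr2 V -> K).

Lemma zopen_basic d (Q : {mpoly K[\dim {:V} * \dim {:V}]}) :
  Q \is d.-homog -> zopen (fun y : gr2 V => pl_eval Q y != 0).
Proof. by move=> hQ x Qx; exists d, Q; split. Qed.

Lemma zopenI D N : zopen D -> zopen N -> zopen (fun y => D y /\ N y).
Proof.
move=> oD oN x [/oD[d [Q [hQ Qx QD]]] /oN[e [P [hP Px PN]]]].
exists (d + e)%N, (Q * P); split; first exact: dhomogM.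
  by rewrite /pl_eval mevalM mulf_neq0.
by move=> y; rewrite /pl_eval mevalM mulf_eq0 negb_or => /andP[/QD ? /PN].
Qed.

Lemma regular_ext D f g :
  regular_on D f -> (forall x, D x -> f x = g x) -> regular_on D g.
Proof.
move=> rf fg x Dx; have [N [d [P [Q [oN Nx hP hQ e]]]]] := rf x Dx.
exists N, d, P, Q; split=> // y Ny; have [Dy Qy <-] := e y Ny.
by split=> //; rewrite fg.
Qed.

Lemma regular_sub D N f :
  regular_on D f -> zopen N -> (forall x, N x -> D x) -> regular_on N f.
Proof.
move=> rf oN ND x Nx; have [M [d [P [Q [oM Mx hP hQ e]]]]] := rf x (ND x Nx).
exists (fun y => M y /\ N y), d, P, Q; split=> //; first exact: zopenI.
by move=> y [My Ny]; have [_ Qy fy] := e y My.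
Qed.

Lemma regular_const D c : zopen D -> regular_on D (fun=> c).
Proof.
move=> oD x Dx; exists D, 0%N, (c *: 1), 1; split=> //.
- by apply: rpredZ; exact: dhomog1.
- exact: dhomog1.
by move=> y Dy; rewrite /pl_eval mevalZ meval1 divr1 mulr1 oner_neq0.
Qed.

Lemma regular_quot d (P Q : {mpoly K[\dim {:V} * \dim {:V}]}) :
  P \is d.-homog -> Q \is d.-homog ->
  regular_on (fun y : gr2 V => pl_eval Q y != 0)
    (fun y => pl_eval P y / pl_eval Q y).
Proof.
move=> hP hQ x Qx; exists (fun y => pl_eval Q y != 0), d, P, Q.
by split=> //; exact: zopen_basic hQ.
Qed.

Lemma regularD D f g :
  regular_on D f -> regular_on D g -> regular_on D (fun x => f x + g x).
Proof.
move=> rf rg x Dx.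
have [N1 [d1 [P1 [Q1 [o1 N1x hP1 hQ1 e1]]]]] := rf x Dx.
have [N2 [d2 [P2 [Q2 [o2 N2x hP2 hQ2 e2]]]]] := rg x Dx.
exists (fun y => N1 y /\ N2 y), (d1 + d2)%N, (P1 * Q2 + Q1 * P2), (Q1 * Q2).
split=> //; first exact: zopenI.
- by rewrite rpredD ?dhomogM.
- by rewrite dhomogM.
move=> y [/e1[Dy Q1y ->] /e2[_ Q2y ->]]; move: Q1y Q2y.
rewrite /pl_eval mevalD !mevalM => Q1y Q2y.
by rewrite mulf_neq0 // addf_div // [X in _ + X]mulrC; split=> //; rewrite [_ * P2.@[_]]mulrC.
Qed.

Lemma regularM D f g :
  regular_on D f -> regular_on D g -> regular_on D (fun x => f x * g x).
Proof.
move=> rf rg x Dx.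
have [N1 [d1 [P1 [Q1 [o1 N1x hP1 hQ1 e1]]]]] := rf x Dx.
have [N2 [d2 [P2 [Q2 [o2 N2x hP2 hQ2 e2]]]]] := rg x Dx.
exists (fun y => N1 y /\ N2 y), (d1 + d2)%N, (P1 * P2), (Q1 * Q2).
split=> //; [exact: zopenI|by rewrite dhomogM|by rewrite dhomogM|].
move=> y [/e1[Dy Q1y ->] /e2[_ Q2y ->]]; move: Q1y Q2y.
by rewrite /pl_eval !mevalM => Q1y Q2y; rewrite mulf_neq0 // mulf_div.
Qed.

Lemma regular_sum D (I : Type) (r : seq I) (F : I -> gr2 V -> K) :
  zopen D -> (forall i, regular_on D (F i)) ->
  regular_on D (fun x => \sum_(i <- r) F i x).
Proof.
move=> oD rF; elim: r => [|i r IH].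
  by apply: regular_ext (regular_const 0 oD) _ => x _; rewrite big_nil.
by apply: regular_ext (regularD (rF i) IH) _ => x _; rewrite big_cons.
Qed.

Lemma regular_prod D (I : Type) (r : seq I) (F : I -> gr2 V -> K) :
  zopen D -> (forall i, regular_on D (F i)) ->
  regular_on D (fun x => \prod_(i <- r) F i x).
Proof.
move=> oD rF; elim: r => [|i r IH].
  by apply: regular_ext (regular_const 1 oD) _ => x _; rewrite big_nil.
by apply: regular_ext (regularM (rF i) IH) _ => x _; rewrite big_cons.
Qed.

Lemma vregular_comb (W : vectType K) D (I : Type) (r : seq I)
    (F : I -> gr2 V -> K) (w : I -> W) :
  zopen D -> (forall i, regular_on D (F i)) ->
  vregular_on D (fun x => \sum_(i <- r) F i x *: w i).
Proof.
move=> oD rF l.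
apply: (@regular_ext _ (fun x => \sum_(i <- r) F i x * l (w i))).
  by apply: regular_sum => // i; apply: regularM => //; exact: regular_const.
by move=> x _; rewrite linear_sum; apply: eq_bigr => i _; rewrite linearZ.
Qed.

Lemma vregular_sum (W : vectType K) D (I : Type) (r : seq I)
    (F : I -> gr2 V -> W) :
  zopen D -> (forall i, vregular_on D (F i)) ->
  vregular_on D (fun x => \sum_(i <- r) F i x).
Proof.
move=> oD rF l.
apply: (@regular_ext _ (fun x => \sum_(i <- r) l (F i x))).
  by apply: regular_sum => // i; exact: rF.
by move=> x _; rewrite linear_sum.
Qed.

Lemma vregular_map (W W' : vectType K) D (s : gr2 V -> W) (f : 'Hom(W, W')) :
  vregular_on D s -> vregular_on D (fun x => f (s x)).
Proof.
move=> rs l; apply: (@regular_ext _ (fun x => (l \o f)%VF (s x))); first exact: rs.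
by move=> x _; rewrite comp_lfunE.
Qed.

Lemma vregular_ext (W : vectType K) D (s t : gr2 V -> W) :
  vregular_on D s -> (forall x, D x -> s x = t x) -> vregular_on D t.
Proof.
by move=> rs st l; apply: regular_ext (rs l) _ => x Dx; rewrite st.
Qed.

Lemma vregular_sub (W : vectType K) D N (s : gr2 V -> W) :
  vregular_on D s -> zopen N -> (forall x, N x -> D x) -> vregular_on N s.
Proof. by move=> rs oN ND l; apply: regular_sub (rs l) oN ND. Qed.

Lemma basis_of_tupleP (W : vectType K) (U : {vspace W}) r (e : 'I_r -> W) :
  (forall i, e i \in U) ->
  (forall v, v \in U -> exists k : 'I_r -> K, v = \sum_i k i *: e i) ->
  (forall k : 'I_r -> K, \sum_i k i *: e i = 0 -> forall i, k i = 0) ->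
  basis_of U [tuple e i | i < r].
Proof.
move=> eU sU fe; rewrite basisEfree size_tuple; apply/and3P; split.
- apply/freeP => k; rewrite (eq_bigr (fun i => k i *: e i)); first exact: fe.
  by move=> i _; rewrite -tnth_nth tnth_mktuple.
- by apply/span_subvP => v /tnthP[i ->]; rewrite tnth_mktuple.
have sub : (U <= <<[tuple e i | i < r]>>)%VS.
  apply/subvP => v /sU[k ->]; apply: rpred_sum => i _; apply: rpredZ.
  by apply: memv_span; apply/tnthP; exists i; rewrite tnth_mktuple.
suff -> : r = \dim <<[tuple e i | i < r]>> by apply: dimvS.
have : free [tuple e i | i < r].
  apply/freeP => k; rewrite (eq_bigr (fun i => k i *: e i)); first exact: fe.
  by move=> i _; rewrite -tnth_nth tnth_mktuple.
by rewrite /free size_tuple => /eqP.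
Qed.
End Regular.

Section Tautological.
Variables (K : fieldType) (V : vectType K).
Local Notation m := (\dim {:V}).
Local Notation crd := (coord (vbasis {:V})).

Lemma gr2_basisP (x : gr2 V) : exists u v,
  [/\ u \in val x, v \in val x,
      forall w, w \in val x -> exists a b, w = a *: u + b *: v,
      forall a b, a *: u + b *: v = 0 -> a = 0 /\ b = 0 &
      forall i j, plucker x i j = crd i u * crd j v - crd j u * crd i v].
Proof.
have dx := eqP (valP x); have bx := vbasisP (val x).
exists (vbasis (val x))`_0, (vbasis (val x))`_1; split.
- by apply: vbasis_mem; rewrite mem_nth // size_tuple dx.
- by apply: vbasis_mem; rewrite mem_nth // size_tuple dx.
- move=> w /(coord_basis bx) ->.
  move: (vbasis (val x)) => b; case: _ / (esym dx) b => b.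
  by exists (coord b ord0 w), (coord b (lift ord0 ord0) w); rewrite !big_ord_recl big_ord0 addr0.
- have := basis_free bx; move: (vbasis (val x)) => b.
  case: _ / (esym dx) b => b /freeP fb a c e.
  pose k (i : 'I_2) := if i == ord0 then a else c.
  have k0 : forall i, k i = 0.
    by apply: fb; rewrite !big_ord_recl big_ord0 addr0.
  by split; [exact: (k0 ord0) | exact: (k0 (lift ord0 ord0))].
by move=> i j; rewrite mxE.
Qed.

Lemma crd_expand (v : V) : v = \sum_i crd i v *: (vbasis {:V})`_i.
Proof. exact: coord_vbasis (memvf v). Qed.

Lemma plucker_neq0 (x : gr2 V) : exists i j, plucker x i j != 0.
Proof.
have [u [v [ux vx _ fr pE]]] := gr2_basisP x.
have [/existsP[i /existsP[j p0]]|] := boolP [exists i, exists j, plucker x i j != 0].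
  by exists i, j.
rewrite negb_exists => /forallP H; exfalso.
have e i j : crd i u * crd j v = crd j u * crd i v.
  move: (H i); rewrite negb_exists => /forallP/(_ j).
  by rewrite negbK pE subr_eq0 => /eqP.
have u0 i : crd i u = 0.
  have : crd i v *: u + (- crd i u) *: v = 0.
    rewrite scaleNr; apply/eqP; rewrite subr_eq0; apply/eqP.
    rewrite [u in LHS]crd_expand [v in RHS]crd_expand !scaler_sumr.
    by apply: eq_bigr => j _; rewrite !scalerA mulrC e.
  by case/fr => _ /eqP; rewrite oppr_eq0 => /eqP.
have [|/eqP] := fr 1 0; last by rewrite oner_eq0.
rewrite scale0r addr0 scale1r (crd_expand u) big1 // => i _.
by rewrite u0 scale0r.
Qed.

Definition plX (i j : 'I_m) : {mpoly K[m * m]} := 'X_(mxvec_index i j).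

Lemma plXE i j x : pl_eval (plX i j) x = plucker x i j.
Proof. by rewrite /pl_eval mevalXU mxvecE. Qed.

Lemma plX_homog i j : plX i j \is 1.-homog.
Proof. by rewrite dhomogX; apply/eqP; exact: mdeg1. Qed.

Lemma taut_loc (x0 : gr2 V) :
  exists (D : gr2 V -> Prop) r (e : 'I_r -> gr2 V -> V),
    [/\ zopen D, D x0, forall i, vregular_on D (e i)
      & forall x, D x -> basis_of (val x) [tuple e i x | i < r]].
Proof.
have [i [j p0]] := plucker_neq0 x0.
pose D (y : gr2 V) := pl_eval (plX i j) y != 0.
have oD : zopen D by apply: (zopen_basic (plX_homog i j)).
pose g (a : 'I_2) k y := if a == ord0 then pl_eval (plX k j) y / pl_eval (plX i j) y
                         else pl_eval (plX i k) y / pl_eval (plX i j) y.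
exists D, 2%N, (fun a y => \sum_k g a k y *: (vbasis {:V})`_k).
split=> //; first by rewrite /D plXE.
  move=> a; apply: vregular_comb => // k; rewrite /g.
  by case: (a == ord0); apply: regular_quot; exact: plX_homog.
move=> y; rewrite /D plXE => Dy.
have [u [v [uy vy sp fr pE]]] := gr2_basisP y.
set p := plucker y i j in Dy.
have cmb (s t : K) : s *: u + t *: v =
    \sum_k (s * crd k u + t * crd k v) *: (vbasis {:V})`_k.
  rewrite {1}[u]crd_expand {1}[v]crd_expand !scaler_sumr -big_split /=.
  by apply: eq_bigr => k _; rewrite !scalerA -scalerDl.
have g0 : \sum_k g ord0 k y *: (vbasis {:V})`_k =
          p^-1 *: (crd j v *: u - crd j u *: v).
  rewrite -scaleNr cmb scaler_sumr; apply: eq_bigr => k _.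
  rewrite /g /= !plXE !scalerA -/p; congr (_ *: _).
  by rewrite mulrC pE; congr (_ * _); ring.
have g1 a : a != ord0 -> \sum_k g a k y *: (vbasis {:V})`_k =
          p^-1 *: (crd i u *: v - crd i v *: u).
  move=> /negPf a0.
  rewrite addrC -scaleNr cmb scaler_sumr; apply: eq_bigr => k _.
  rewrite /g a0 !plXE !scalerA -/p; congr (_ *: _).
  by rewrite mulrC pE; congr (_ * _); ring.
have comb (s t x1 x2 y1 y2 : K) :
  s *: (x1 *: u - x2 *: v) + t *: (y1 *: v - y2 *: u) =
  (s * x1 - t * y2) *: u + (t * y1 - s * x2) *: v.
  rewrite !scalerBr !scalerA !scalerBl addrACA [RHS]addrACA; congr (_ + _).
  by rewrite addrC.
have pp : p = crd i u * crd j v - crd j u * crd i v by exact: pE.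
apply: basis_of_tupleP => [a|w /sp[a [b] ->]|k].
- have [->|/g1 ->] := eqVneq a ord0; first rewrite g0;
    by rewrite rpredZ // rpredB // rpredZ.
- pose c t := a * crd t u + b * crd t v.
  exists (fun t : 'I_2 => if t == ord0 then c i else c j).
  rewrite !big_ord_recl big_ord0 addr0 /= g0 g1 //.
  rewrite !scalerA comb; congr (_ *: _ + _ *: _); apply: (mulfI Dy).
    by rewrite mulrBr !mulrA ![p * _]mulrC !mulfK // pp /c; ring.
  by rewrite mulrBr !mulrA ![p * _]mulrC !mulfK // pp /c; ring.
rewrite !big_ord_recl big_ord0 addr0 /= g0 g1 //.
set k0 := k ord0; set k1 := k _ => e.
move: e; rewrite !scalerA comb => /fr[e1 e2].
have {}e1 : k0 * crd j v = k1 * crd i v.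
  by apply/eqP; rewrite -subr_eq0 -(mulIr_eq0 _ (mulIf (invr_neq0 Dy))) mulrBl -e1; apply/eqP; ring.
have {}e2 : k0 * crd j u = k1 * crd i u.
  by apply/eqP; rewrite eq_sym -subr_eq0 -(mulIr_eq0 _ (mulIf (invr_neq0 Dy))) mulrBl -e2; apply/eqP; ring.
have k00 : k0 = 0.
  apply/eqP; rewrite -(mulIr_eq0 _ (mulIf Dy)) pp; apply/eqP.
  have -> : k0 * (crd i u * crd j v - crd j u * crd i v)
     = crd i u * (k0 * crd j v) - (k0 * crd j u) * crd i v by ring.
  by rewrite e1 e2; ring.
have k10 : k1 = 0.
  apply/eqP; rewrite -(mulIr_eq0 _ (mulIf Dy)) pp; apply/eqP.
  have -> : k1 * (crd i u * crd j v - crd j u * crd i v)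
     = (k1 * crd i u) * crd j v - crd j u * (k1 * crd i v) by ring.
  by rewrite -e1 -e2; ring.
move=> a; have [->//|a0] := eqVneq a ord0.
rewrite -k10 /k1; congr (k _); apply/val_inj; move: a0.
by case: a => [[|[|[]]]].
Qed.

Definition taut_bundle : vbundle V := VBundle taut_loc.

End Tautological.

Section TensorBundles.
Variable K : fieldType.

Section Spaces.
Variables (n : nat) (W : vectType K).
Local Notation crd := (coord (vbasis {:W})).

Lemma galg_act_is_linear (a : 'S_n -> K) : linear (@galg_act K n W a).
Proof.
move=> c t t'; apply/ffunP => f; rewrite !ffunE scaler_sumr -big_split /=.
apply: eq_bigr => s _; rewrite !ffunE mulrDr; congr (_ + _).
exact: mulrCA.
Qed.

HB.instance Definition _ (a : 'S_n -> K) :=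
  GRing.isLinear.Build K (tens n W) (tens n W) *:%R (@galg_act K n W a)
    (galg_act_is_linear a).

Lemma galg_act_pure (a : 'S_n -> K) (v : 'I_n -> W) :
  galg_act a (pure v) = \sum_s a s *: pure (fun i => v ((s^-1)%g i)).
Proof.
apply/ffunP => f; rewrite !ffunE sum_ffunE; apply: eq_bigr => s _.
rewrite !ffunE; congr (_ * _).
rewrite [RHS](reindex_inj (@perm_inj _ s)) /=.
by apply: eq_bigr => i _; rewrite ffunE permK.
Qed.

Lemma pure_expand (I : finType) (c : 'I_n -> I -> K) (e : I -> W) :
  pure (fun i => \sum_k c i k *: e k) =
  \sum_(f : {ffun 'I_n -> I}) (\prod_i c i (f i)) *: pure (fun i => e (f i)).
Proof.
apply/ffunP => g; rewrite ffunE sum_ffunE.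
rewrite (eq_bigr (fun i => \sum_k c i k * crd (g i) (e k))); last first.
  by move=> i _; rewrite linear_sum; apply: eq_bigr => k _; rewrite linearZ.
rewrite bigA_distr_bigA; apply: eq_bigr => f _.
by rewrite !ffunE big_split.
Qed.

Lemma eq_pure (v w : 'I_n -> W) : v =1 w -> pure v = pure w.
Proof.
by move=> vw; apply/ffunP => g; rewrite !ffunE; apply: eq_bigr => i _; rewrite vw.
Qed.

Lemma pure_mem (U : {vspace W}) (v : 'I_n -> W) :
  (forall i, v i \in U) -> pure v \in tens_sub n U.
Proof.
move=> vU; pose b (k : 'I_(\dim U)) := (vbasis U)`_k.
rewrite (@eq_pure _ (fun i => \sum_k coord (vbasis U) k (v i) *: b k)); last first.
  by move=> i; rewrite {1}(coord_vbasis (vU i)).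
rewrite (pure_expand (fun i k => coord (vbasis U) k (v i)) b).
apply: rpred_sum => f _; apply: rpredZ; apply: memv_span.
by apply/mapP; exists f; rewrite ?mem_enum.
Qed.

Section Frame.
Variables (r : nat) (U : {vspace W}) (e : 'I_r -> W).
Hypothesis eU : basis_of U [tuple e i | i < r].

Let eK v : v \in U -> v = \sum_k coord [tuple e i | i < r] k v *: e k.
Proof.
move=> /(coord_basis eU) {1}->; apply: eq_bigr => k _.
by rewrite -tnth_nth tnth_mktuple.
Qed.

Let e_mem k : e k \in U.
Proof.
apply: (basis_mem eU); apply/tnthP; exists k; by rewrite tnth_mktuple.
Qed.

Lemma tens_subE t : t \in tens_sub n U ->
  exists c : {ffun 'I_n -> 'I_r} -> K, t = \sum_f c f *: pure (fun i => e (f i)).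
Proof.
pose X := [tuple pure (fun i => e ((enum_val h : {ffun 'I_n -> 'I_r}) i))
            | h < #|{ffun 'I_n -> 'I_r}|].
have H : (tens_sub n U <= <<X>>)%VS.
  apply/span_subvP => _ /mapP[f _ ->].
  set b := fun i => _.
  rewrite (@eq_pure _
    (fun i => \sum_k coord [tuple e i | i < r] k (b i) *: e k)); last first.
    move=> i; apply: eK; apply: vbasis_mem; rewrite /b.
    by apply: mem_nth; rewrite size_tuple.
  rewrite (pure_expand (fun i k => coord [tuple e i | i < r] k (b i)) e).
  apply: rpred_sum => g _; apply: rpredZ; apply: memv_span.
  by apply/tnthP; exists (enum_rank g); rewrite tnth_mktuple enum_rankK.
move=> /(subvP H) tS; exists (fun f => coord X (enum_rank f) t).
rewrite {1}(coord_span tS) (reindex_onto enum_rank enum_val); last first.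
  by move=> i _; rewrite enum_valK.
apply: eq_big => [f|f _]; first by rewrite enum_rankK eqxx.
by rewrite -tnth_nth tnth_mktuple enum_rankK.
Qed.

Lemma pure_free (c : {ffun 'I_n -> 'I_r} -> K) :
  \sum_f c f *: pure (fun i => e (f i)) = 0 -> forall f, c f = 0.
Proof.
move=> c0 f; have fe := basis_free eU.
pose phi k : W -> K := coord [tuple e i | i < r] k.
pose Phi (t : tens n W) : K :=
  \sum_g (t g : K) * \prod_i phi (f i) (vbasis {:W})`_(g i).
have PhiE v : Phi (pure v) = \prod_i phi (f i) (v i).
  transitivity (\prod_i \sum_k crd k (v i) * phi (f i) (vbasis {:W})`_k).
    rewrite bigA_distr_bigA; apply: eq_bigr => g _.
    by rewrite ffunE -big_split.
  apply: eq_bigr => i _; rewrite [v i in RHS]crd_expand [RHS]linear_sum.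
  by apply: eq_bigr => k _; rewrite /phi linearZ.
have : Phi (\sum_f c f *: pure (fun i => e (f i))) = 0.
  by rewrite c0 /Phi big1 // => g _; rewrite ffunE mul0r.
rewrite /Phi (eq_bigr (fun g => \sum_h c h *
  ((pure (fun i => e (h i)) g : K) * \prod_i phi (f i) (vbasis {:W})`_(g i)))); last first.
  move=> g _; rewrite sum_ffunE mulr_suml; apply: eq_bigr => h _.
  by rewrite !ffunE mulrA.
rewrite exchange_big /= (eq_bigr (fun h : {ffun 'I_n -> 'I_r} => c h * (h == f)%:R)).
  rewrite (bigD1 f) //= eqxx mulr1 big1 ?addr0 // => h /negPf ->.
  by rewrite mulr0.
move=> h _; rewrite -mulr_sumr; congr (_ * _); rewrite -/(Phi _) PhiE.
rewrite (eq_bigr (fun i => (f i == h i)%:R)); last first.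
  move=> i _; rewrite /phi -[e (h i)](tnth_mktuple e) (tnth_nth 0).
  by rewrite eq_sym; exact: coord_free.
have [->|hf] := eqVneq h f; first by rewrite big1 // => i _; rewrite eqxx.
have [i ne] : exists i, f i != h i.
  apply/existsP; rewrite -negb_forall; apply: contra hf => /forallP H.
  by apply/eqP/ffunP => i; apply/esym/eqP.
by rewrite (bigD1 i) //= (negPf ne) mul0r.
Qed.

Let N := #|{ffun 'I_n -> 'I_r}|.

Definition galg_mx (a : 'S_n -> K) : 'M[K]_N :=
  \matrix_(f, h) \sum_(s : 'S_n |
    [ffun i : 'I_n => (enum_val f : {ffun 'I_n -> 'I_r}) ((s^-1)%g i)] == enum_val h) a s.

Definition galg_frame (a : 'S_n -> K) (k : 'I_(\rank (galg_mx a))) : tens n W :=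
  \sum_h row_base (galg_mx a) k h *: pure (fun i => e ((enum_val h : {ffun 'I_n -> 'I_r}) i)).
Arguments galg_frame : clear implicits.

Let P (h : 'I_N) : tens n W := pure (fun i => e ((enum_val h : {ffun 'I_n -> 'I_r}) i)).

Let actP a f : galg_act a (P f) = \sum_h galg_mx a f h *: P h.
Proof.
rewrite /P galg_act_pure.
rewrite (partition_big (fun s : 'S_n =>
   enum_rank [ffun i : 'I_n => (enum_val f : {ffun 'I_n -> 'I_r}) ((s^-1)%g i)]) predT) //=.
apply: eq_bigr => h _; rewrite mxE scaler_suml.
apply: eq_big => [s|s /eqP <-].
  by rewrite -(inj_eq enum_val_inj) enum_rankK.
by rewrite enum_rankK; congr (_ *: _); apply: eq_pure => i; rewrite ffunE.
Qed.

Lemma galg_basis a :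
  basis_of (galg_im a U) [tuple galg_frame a k | k < \rank (galg_mx a)].
Proof.
have sumP (c : {ffun 'I_n -> 'I_r} -> K) :
    \sum_f c f *: pure (fun i => e (f i)) = \sum_h c (enum_val h) *: P h.
  by rewrite (reindex_onto enum_val enum_rank) //= => [|f _];
    [apply: eq_bigl => h; rewrite enum_valK eqxx | rewrite enum_rankK].
have Pfree (c : 'I_N -> K) : \sum_h c h *: P h = 0 -> forall h, c h = 0.
  move=> c0 h; rewrite -[h]enum_valK.
  apply: (pure_free (c := fun f => c (enum_rank f))).
  by rewrite sumP -[RHS]c0; apply: eq_bigr => k _; rewrite enum_valK.
have PU h : P h \in tens_sub n U by apply: pure_mem.
apply: basis_of_tupleP => [k|v|c].
- have /submxP[D DE] : (row_base (galg_mx a) <= galg_mx a)%MS by rewrite eq_row_base.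
  have -> : galg_frame a k = linfun (galg_act a) (\sum_f D k f *: P f).
    rewrite lfunE /= linear_sum /galg_frame DE.
    under eq_bigr => h _ do rewrite mxE scaler_suml.
    rewrite exchange_big /=; apply: eq_bigr => f _.
    rewrite linearZ /= actP scaler_sumr; apply: eq_bigr => h _.
    by rewrite scalerA.
  by apply: memv_img; apply: rpred_sum => f _; apply: rpredZ.
- move=> /memv_imgP[t /tens_subE[c ->] ->]; rewrite sumP lfunE /=.
  have /submxP[D DE] : (galg_mx a <= row_base (galg_mx a))%MS by rewrite eq_row_base.
  exists (fun k => \sum_f c (enum_val f) * D f k).
  rewrite linear_sum /=.
  transitivity (\sum_f \sum_k (c (enum_val f) * D f k) *: galg_frame a k); last first.
    by rewrite exchange_big /=; apply: eq_bigr => k _; rewrite scaler_suml.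
  apply: eq_bigr => f _; rewrite linearZ /= actP {1}DE.
  under [RHS]eq_bigr => k _ do rewrite -scalerA.
  rewrite -scaler_sumr; congr (_ *: _).
  under eq_bigr => h _ do rewrite mxE scaler_suml.
  rewrite exchange_big /=; apply: eq_bigr => k _.
  by rewrite /galg_frame scaler_sumr; apply: eq_bigr => h _; rewrite scalerA.
move=> c0; pose rc : 'rV_(\rank (galg_mx a)) := \row_k c k.
suff rc0 : rc = 0 by move=> k; have := congr1 (fun M : 'rV_ _ => M 0 k) rc0; rewrite !mxE.
apply: (row_free_inj (row_base_free (galg_mx a))); rewrite /= mul0mx.
apply/rowP => h; rewrite [RHS]mxE; move: h.
apply: Pfree; rewrite -[RHS]c0.
under eq_bigr => h _ do rewrite mxE scaler_suml.
rewrite exchange_big /=; apply: eq_bigr => k _.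
rewrite /galg_frame scaler_sumr; apply: eq_bigr => h _.
by rewrite mxE scalerA.
Qed.
End Frame.

Lemma vregular_pure (V : vectType K) (D : gr2 V -> Prop)
    (v : 'I_n -> gr2 V -> W) :
  zopen D -> (forall i, vregular_on D (v i)) ->
  vregular_on D (fun x => pure (fun i => v i x)).
Proof.
move=> oD rv.
pose dl (g : {ffun 'I_n -> 'I_(\dim {:W})}) : tens n W := [ffun h => (h == g)%:R].
have H : vregular_on (W := tens n W) D
    (fun x => \sum_(g : {ffun 'I_n -> 'I_(\dim {:W})}) (\prod_i crd (g i) (v i x)) *: dl g).
  apply: vregular_comb => // g; apply: regular_prod => // i.
  pose l : {linear W -> K^o} := crd (g i).
  have := rv i (linfun l).
  by move/regular_ext; apply => x _; rewrite lfunE.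
apply: (vregular_ext H) => x _; apply/ffunP => h; rewrite sum_ffunE (bigD1 h) //= !ffunE eqxx.
rewrite [X in _ + X]big1 ?addr0; first exact: mulr1.
by move=> g /negPf gh; rewrite !ffunE eq_sym gh; exact: mulr0.
Qed.
End Spaces.

Section Bundles.
Variable V : vectType K.

Lemma galg_loc n (a : 'S_n -> K) (E : vbundle V) (x0 : gr2 V) :
  exists (D : gr2 V -> Prop) r (e : 'I_r -> gr2 V -> tens n (vb_amb E)),
    [/\ zopen D, D x0, forall i, vregular_on D (e i)
      & forall x, D x -> basis_of (galg_im a (E x)) [tuple e i x | i < r]].
Proof.
have [D [r [e [oD Dx0 re be]]]] := vb_loc E x0.
exists D, _, (fun k x => galg_frame (fun i => e i x) (a := a) k); split=> //.
  move=> k; apply: vregular_sum => // h l.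
  apply: (@regular_ext _ _ _ (fun x => row_base (galg_mx r a) k h *
     l (pure (fun i => e ((enum_val h : {ffun 'I_n -> 'I_r}) i) x)))).
    apply: regularM; first exact: regular_const.
    exact: (vregular_pure (v := fun i => e ((enum_val h : {ffun 'I_n -> 'I_r}) i))).
  by move=> x _; rewrite linearZ.
by move=> x Dx; apply: galg_basis (be x Dx) a.
Qed.

Definition galg_bundle n (a : 'S_n -> K) (E : vbundle V) : vbundle V :=
  VBundle (galg_loc a E).

End Bundles.
End TensorBundles.

Section DirectSum.
Variables (K : fieldType) (V : vectType K).

Definition dsum_fib (W1 W2 : vectType K) (U1 : {vspace W1}) (U2 : {vspace W2}) :
    {vspace W1 * W2} :=
  (linfun (@fst W1 W2) @^-1: U1 :&: linfun (@snd W1 W2) @^-1: U2)%VS.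

Lemma dsum_fibE (W1 W2 : vectType K) (U1 : {vspace W1}) (U2 : {vspace W2}) v :
  (v \in dsum_fib U1 U2) = (v.1 \in U1) && (v.2 \in U2).
Proof. by rewrite memv_cap -!memv_preim !lfunE. Qed.

Definition pair_inl (W1 W2 : vectType K) (v : W1) : W1 * W2 := (v, 0).
Definition pair_inr (W1 W2 : vectType K) (v : W2) : W1 * W2 := (0, v).

Lemma pair_inl_linear (W1 W2 : vectType K) : linear (@pair_inl W1 W2).
Proof. by move=> c u v; congr (_, _); rewrite /= scaler0 addr0. Qed.
Lemma pair_inr_linear (W1 W2 : vectType K) : linear (@pair_inr W1 W2).
Proof. by move=> c u v; congr (_, _); rewrite /= scaler0 addr0. Qed.

HB.instance Definition _ (W1 W2 : vectType K) :=
  GRing.isLinear.Build K W1 (W1 * W2)%type *:%R (@pair_inl W1 W2)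
    (@pair_inl_linear W1 W2).
HB.instance Definition _ (W1 W2 : vectType K) :=
  GRing.isLinear.Build K W2 (W1 * W2)%type *:%R (@pair_inr W1 W2)
    (@pair_inr_linear W1 W2).

Lemma dsum_loc (E F : vbundle V) (x0 : gr2 V) :
  exists (D : gr2 V -> Prop) r (e : 'I_r -> gr2 V -> (vb_amb E * vb_amb F)%type),
    [/\ zopen D, D x0, forall i, vregular_on D (e i)
      & forall x, D x -> basis_of (dsum_fib (E x) (F x)) [tuple e i x | i < r]].
Proof.
have [D1 [r1 [e1 [o1 D1x re1 be1]]]] := vb_loc E x0.
have [D2 [r2 [e2 [o2 D2x re2 be2]]]] := vb_loc F x0.
have oD := zopenI o1 o2.
pose e (i : 'I_(r1 + r2)) y := match split i with
  | inl j => linfun (@pair_inl (vb_amb E) (vb_amb F)) (e1 j y)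
  | inr j => linfun (@pair_inr (vb_amb E) (vb_amb F)) (e2 j y) end.
have el y j : e (lshift r2 j) y = (e1 j y, 0).
  by rewrite /e; case: split_ordP => k /eqP; rewrite ?eq_shift // => /eqP ->; rewrite lfunE.
have er y j : e (rshift r1 j) y = (0, e2 j y).
  by rewrite /e; case: split_ordP => k /eqP; rewrite ?eq_shift // => /eqP ->; rewrite lfunE.
have sumE y (k : 'I_(r1 + r2) -> K) : \sum_i k i *: e i y =
    (\sum_j k (lshift r2 j) *: e1 j y, \sum_j k (rshift r1 j) *: e2 j y).
  rewrite big_split_ord /=.
  under eq_bigr => j _ do rewrite el.
  under [X in _ + X]eq_bigr => j _ do rewrite er.
  apply/pair_eqP; rewrite /= /pair_eq /= !raddf_sum /=.
  rewrite [X in _ + X]big1 ?addr0 => [|j _]; last by rewrite /= scaler0.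
  rewrite eqxx /= [X in X + _]big1 ?add0r => [|j _]; last by rewrite /= scaler0.
  exact: eqxx.
exists (fun y => D1 y /\ D2 y), (r1 + r2)%N, e; split=> //.
  move=> i; rewrite /e; case: split => j; apply: vregular_map.
    by apply: vregular_sub (re1 j) oD _ => x [].
  by apply: vregular_sub (re2 j) oD _ => x [].
move=> y [/be1 b1 /be2 b2].
have m1 j : e1 j y \in E y.
  by apply: (basis_mem b1); apply/tnthP; exists j; rewrite tnth_mktuple.
have m2 j : e2 j y \in F y.
  by apply: (basis_mem b2); apply/tnthP; exists j; rewrite tnth_mktuple.
apply: basis_of_tupleP => [i|[v w]|k].
- by rewrite dsum_fibE -[i]splitK; case: (split i) => j /=;
    rewrite ?el ?er /= ?m1 ?m2 mem0v.
- rewrite dsum_fibE /= => /andP[vE wF].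
  exists (fun i => match split i with
    | inl j => coord [tuple e1 i y | i < r1] j v
    | inr j => coord [tuple e2 i y | i < r2] j w end).
  rewrite sumE; congr (_, _).
    rewrite [LHS](coord_basis b1 vE); apply: eq_bigr => j _.
    rewrite -tnth_nth tnth_mktuple; congr (_ *: _).
    by case: split_ordP => k /eqP; rewrite ?eq_shift // => /eqP ->.
  rewrite [LHS](coord_basis b2 wF); apply: eq_bigr => j _.
  rewrite -tnth_nth tnth_mktuple; congr (_ *: _).
  by case: split_ordP => k /eqP; rewrite ?eq_shift // => /eqP ->.
rewrite sumE => -[k1 k2] i.
have /freeP f1 := basis_free b1; have /freeP f2 := basis_free b2.
rewrite -[i]splitK; case: (split i) => j /=.
  apply: (f1 (fun j => k (lshift r2 j))); rewrite -[RHS]k1.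
  by apply: eq_bigr => l _; rewrite -tnth_nth tnth_mktuple.
apply: (f2 (fun j => k (rshift r1 j))); rewrite -[RHS]k2.
by apply: eq_bigr => l _; rewrite -tnth_nth tnth_mktuple.
Qed.

Definition dsum_bundle (E F : vbundle V) : vbundle V := VBundle (dsum_loc E F).

(* S^k, Lambda^k and Sigma^la, realised inside tensor powers as the images of *)
(* the (anti)symmetrizer and of the Young symmetrizer; this is the usual      *)
(* meaning in characteristic 0 only. By young_row and young_col below,        *)
(* Sigma^(k) and Sigma^(1^k) are given by the same group algebra elements as  *)
(* S^k and Lambda^k.                                                          *)
Definition sym_bundle k (E : vbundle V) := galg_bundle (@symmetrizer K k) E.
Definition ext_bundle k (E : vbundle V) := galg_bundle (@antisymmetrizer K k) E.
Definition schur_bundle la (E : vbundle V) :=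
  galg_bundle (@young_symmetrizer K la) E.

End DirectSum.

Lemma young_row (K : fieldType) k (s : 'S_(sumn [:: k])) :
  young_symmetrizer [:: k] s = 1 :> K.
Proof.
have ri i : (i < k)%N -> reshape_index [:: k] i = 0%N.
  by move=> ik; rewrite /reshape_index /= subn_eq0 ik.
have ro i : (i < k)%N -> reshape_offset [:: k] i = i.
  by move=> ik; rewrite /reshape_offset ri // take0 subn0.
have lt (i : 'I_(sumn [:: k])) : (i < k)%N by case: i => i /=; rewrite addn0.
have rT : row_stab [:: k] = [set: _].
  by apply/setP => p; rewrite !inE; apply/forallP => i; rewrite !ri.
have c1 : col_stab [:: k] = [set 1%g].
  apply/setP => p; rewrite !inE; apply/forallP/eqP => [H|-> i]; last by rewrite perm1.
  by apply/permP => i; apply/val_inj; move/eqP: (H i); rewrite perm1 !ro.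
rewrite /young_symmetrizer rT c1 (bigD1 s) ?inE //= (big_pred1 1%g); last first.
  by move=> q; rewrite inE /=; case: eqP => // ->; rewrite mul1g eqxx.
rewrite odd_perm1 big1 ?addr0 // => p /andP[_ ps].
by apply: big1 => q /andP[/set1P ->]; rewrite mul1g (negPf ps).
Qed.

Lemma young_col (K : fieldType) k (s : 'S_(sumn (nseq k 1%N))) :
  young_symmetrizer (nseq k 1%N) s = (-1) ^+ s :> K.
Proof.
have lt (i : 'I_(sumn (nseq k 1%N))) : (i < k)%N.
  by case: i => i /=; rewrite sumn_nseq mul1n.
have ri (i : 'I_(sumn (nseq k 1%N))) :
  reshape_index (nseq k 1%N) i = i /\ reshape_offset (nseq k 1%N) i = 0%N.
  have := reshape_offsetP (ltn_ord i); have := reshape_indexP (ltn_ord i).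
  have := reshape_indexK (nseq k 1%N) i; rewrite size_nseq.
  set a := reshape_index _ _; set b := reshape_offset _ _ => e ak.
  rewrite nth_nseq ak ltnS leqn0 => /eqP b0; split=> //.
  by move: e; rewrite b0 /flatten_index addn0 take_nseq ?sumn_nseq ?mul1n // ltnW.
have cT : col_stab (nseq k 1%N) = [set: _].
  apply/setP => p; rewrite !inE; apply/forallP => i.
  by rewrite (ri i).2 (ri (p i)).2.
have r1 : row_stab (nseq k 1%N) = [set 1%g].
  apply/setP => p; rewrite !inE; apply/forallP/eqP => [H|-> i]; last by rewrite perm1.
  by apply/permP => i; apply/val_inj; move/eqP: (H i); rewrite perm1 (ri i).1 (ri (p i)).1.
rewrite /young_symmetrizer cT r1 big_set1 (big_pred1 s) // => q.
by rewrite inE mulg1.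
Qed.

(* Main.v *)
(* Let U be a fibre of S, with basis x, y, and put u_s = x + s y. Antisymmetric *)
(* tensors of binary cubics in n variables are divisible by the discriminant,   *)
(* whence Lambda^n S^3 U = S^n (S^(4-n) U) (x) (Lambda^2 U)^(n(n-1)/2). The     *)
(* projections onto the Schur powers in question are transvectants: composites  *)
(* of a permutation of the 3n tensor factors with a Young symmetrizer, hence    *)
(* restrictions of linear maps independent of the point of the Grassmannian.    *)
(* They send the antisymmetrization of u_(b_1)^3 (x) ... (x) u_(b_n)^3 to       *)
(* prod_(i < j) (b_j - b_i)^m times prod_i u_(b_i)^e, up to a nonzero constant, *)
(* where (m, e) = (3, 0) for Sigma^(3,3) and (m, e) = (1, 4 - n) otherwise. For *)
(* b running through the n-subsets of {0, 1, 2, 3} these images are             *)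
(* independent, and both sides have dimension at most binomial(4, n), so the    *)
(* map is an isomorphism on fibres; by Cramer's rule its inverse is regular.    *)

Require Import Defs.
From mathcomp Require Import all_boot all_algebra.
From mathcomp Require Import reals complex.
From HB Require Import structures.
From mathcomp Require Import all_fingroup ring zify.

Set Implicit Arguments.
Unset Strict Implicit.
Unset Printing Implicit Defensive.

Import GRing.Theory.
Local Open Scope ring_scope.

(** * Regularity of fibrewise inverses *)

(** On a fibre [U] of rank 2, dimensions are only bounded from above: [dim_ext_le] and [dim_sym_le]
    give binomial(4, n) for Lambda^n S^3 U, and [dim_schur2_le] gives k + 1 for Sigma^(k+l,l) U. In
    all three cases both sides get the same bound p (6 = 5 + 1, 4 and 1). Hence one linear map,
    independent of the point, that respects the fibres and sends p vectors to independent ones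
    forces all dimensions to be p and is an isomorphism on fibres ([vb_isomorphic_dim]). Its inverse
    varies with the point, but regularly ([vb_isomorphic_const], through [regular_frame_coef]).

    The map is [transvectant]; the p test vectors are the wedges of cubes of u_s = x + s y, with s
    running through an n-subset of {0, 1, 2, 3}. Contracting the first row with a form vanishing at
    u_z and the second with a fixed form ([tens_form_young]) turns a linear relation among the
    images into an identity in z ([transvectant_ext_powers], [transvectant_relation]). Independence
    is then interpolation: for n = 3 one term survives at each z = i, for n = 4 a single Vandermonde
    product is nonzero, and for n = 2 the two Schur powers together give an invertible 6 x 6
    system. *)

Section RegularFunctions.
Variables (K : fieldType) (V : vectType K).
Implicit Types (D N : gr2 V -> Prop) (f : gr2 V -> K).

Lemma regular_local D f :
  (forall x, D x -> exists N, [/\ zopen N, N x, forall y, N y -> D y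
                                & regular_on N f]) -> regular_on D f.
Proof.
move=> loc x /loc[N [oN Nx ND rf]].
have [M [d [P [Q [oM Mx hP hQ e]]]]] := rf x Nx.
by exists M, d, P, Q; split=> // y /e[/ND].
Qed.

Lemma zopen_neq0 D f : zopen D -> regular_on D f ->
  zopen (fun y => D y /\ f y != 0).
Proof.
move=> oD rf x [Dx fx]; have [N [d [P [Q [oN Nx hP hQ e]]]]] := rf x Dx.
have Px : pl_eval P x != 0.
  have [_ _ fE] := e x Nx; apply: contraNneq fx; rewrite fE => ->.
  by rewrite mul0r.
have [//|d' [Q' [hQ' Q'x Q'N]]] := zopenI oN (zopen_basic hP) (x := x).
exists d', Q'; split=> // y /Q'N[Ny Py].
by have [Dy Qy ->] := e y Ny; rewrite mulf_neq0 ?invr_neq0.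
Qed.

Lemma regularV D f : zopen D -> regular_on D f ->
  regular_on (fun y => D y /\ f y != 0) (fun y => (f y)^-1).
Proof.
move=> oD rf x [Dx fx]; have [N [d [P [Q [oN Nx hP hQ e]]]]] := rf x Dx.
exists (fun y => N y /\ (D y /\ f y != 0)), d, Q, P; split=> //.
  by apply: zopenI => //; apply: zopen_neq0.
move=> y [Ny Dfy]; have [Dy Qy fE] := e y Ny; split=> //.
  by apply: contraNneq Dfy.2; rewrite fE => ->; rewrite mul0r.
by rewrite fE invf_div.
Qed.

Lemma regular_det D r (A : gr2 V -> 'M[K]_r) : zopen D ->
  (forall i j, regular_on D (fun x => A x i j)) ->
  regular_on D (fun x => \det (A x)).
Proof.
move=> oD rA; apply: regular_sum => // s; apply: regularM.
  exact: regular_const.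
exact: regular_prod.
Qed.

(** The adjugate is polynomial in the entries, and so is the determinant it is divided by. *)
Lemma regular_invmx D r (A : gr2 V -> 'M[K]_r) i j : zopen D ->
  (forall i j, regular_on D (fun x => A x i j)) ->
  regular_on (fun x => D x /\ \det (A x) != 0) (fun x => invmx (A x) i j).
Proof.
move=> oD rA; have rd := regular_det oD rA.
have oN := zopen_neq0 oD rd.
apply: (@regular_ext _ _ _ (fun x => (\det (A x))^-1 * cofactor (A x) j i)).
  apply: regularM; first exact: regularV.
  apply: regularM; first exact: regular_const.
  apply: regular_det => // a b.
  apply: (@regular_ext _ _ _ (fun x => A x (lift j a) (lift i b))).
    by apply: regular_sub (rA _ _) oN _ => y [].
  by move=> y _; rewrite !mxE.
by move=> x [_ dx]; rewrite /invmx unitmxE unitfE dx !mxE.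
Qed.

(* Cramer's rule, after a constant right inverse of the matrix of the frame   *)
(* at x0 has made that matrix square.                                         *)
Lemma regular_frame_coef (W : vectType K) D r (e : 'I_r -> gr2 V -> W)
    (s : gr2 V -> W) (c : 'I_r -> gr2 V -> K) x0 :
  zopen D -> D x0 -> (forall i, vregular_on D (e i)) -> vregular_on D s ->
  (forall k, \sum_i k i *: e i x0 = 0 -> forall i, k i = 0) ->
  (forall x, D x -> s x = \sum_i c i x *: e i x) ->
  exists N, [/\ zopen N, N x0, forall x, N x -> D x
              & forall i, regular_on N (c i)].
Proof.
move=> oD Dx0 re rs fe sE.
pose crd j : 'Hom(W, K^o) := linfun (coord (vbasis {:W}) j : {linear W -> K^o}).
pose M x : 'M[K]_(r, \dim {:W}) := \matrix_(i, j) crd j (e i x).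
have freeM : row_free (M x0).
  apply: inj_row_free => k k0; apply/rowP => i; rewrite mxE; move: i.
  apply: (fe (fun i => k 0 i)).
  rewrite [LHS](coord_vbasis (memvf _)) big1 // => j _.
  have -> : coord (vbasis {:W}) j (\sum_i k 0 i *: e i x0) = 0.
    move/rowP/(_ j): k0; rewrite !mxE => k0; rewrite linear_sum -[RHS]k0.
    by apply: eq_bigr => i _; rewrite linearZ mxE lfunE.
  exact: scale0r.
pose G x := M x *m pinvmx (M x0).
have G1 : G x0 = 1%:M by apply: mulmxVp.
have rG i j : regular_on D (fun x => G x i j).
  apply: (@regular_ext _ _ _ (fun x => \sum_k crd k (e i x) * pinvmx (M x0) k j)).
    apply: regular_sum => // k; apply: regularM; first exact: re.
    exact: regular_const.
  by move=> x _; rewrite [RHS]mxE; apply: eq_bigr => k _; rewrite [in RHS]mxE.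
have rd := regular_det oD rG.
pose N x := D x /\ \det (G x) != 0.
have oN : zopen N by apply: zopen_neq0.
exists N; split=> //; [by rewrite /N G1 det1 oner_neq0|by move=> x []|].
move=> i; pose h x k := \sum_j crd j (s x) * pinvmx (M x0) j k.
apply: (@regular_ext _ _ _ (fun x => \sum_k h x k * invmx (G x) k i)).
  apply: regular_sum => // k; apply: regularM.
    apply: regular_sum => // j; apply: regularM; last exact: regular_const.
    by apply: regular_sub (rs _) oN _ => y [].
  exact: regular_invmx.
(* The row of coefficients times [G x] is [h x], so it is recovered as [h x] times the inverse of
   [G x]. *)
move=> x [Dx dx]; pose cx : 'rV_r := \row_i c i x.
have -> : c i x = cx 0 i by rewrite mxE.
have uG : G x \in unitmx by rewrite unitmxE unitfE.
rewrite -[cx](mulmxK uG) mxE; apply: eq_bigr => k _; congr (_ * _).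
rewrite /G mulmxA mxE; apply: eq_bigr => j _; congr (_ * _).
rewrite mxE sE // linear_sum; apply: eq_bigr => a _.
by rewrite linearZ /= !mxE.
Qed.

(** A constant map preserves regularity. For the inverse, take a local frame e_i of [E]: the
    coefficients of the preimage of a section s along e_i are those of s along phi(e_i). These
    vectors are independent by injectivity, so [regular_frame_coef] applies. *)
Lemma vb_isomorphic_const (E F : vbundle V) (phi : 'Hom(vb_amb E, vb_amb F)) :
  (forall x v, v \in E x -> phi v = 0 -> v = 0) ->
  (forall x, (phi @: E x)%VS = F x) -> vb_isomorphic E F.
Proof.
move=> phiI phiE.
have phi_inj x v w : v \in E x -> w \in E x -> phi v = phi w -> v = w.
  move=> vE wE vw; apply/eqP; rewrite -subr_eq0; apply/eqP.
  by apply: (phiI x); rewrite ?rpredB // linearB /= vw subrr.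
(* The inner inverse is a generalized inverse on the ambient spaces: on the image it returns some
   preimage under [phi \o projv (E x)], and projecting that preimage gives a vector of [E x] which
   [phi] sends to the given one. *)
pose psi x := (projv (E x) \o (phi \o projv (E x))^-1)%VF.
have psi_in x w : psi x w \in E x by rewrite comp_lfunE memv_proj.
have phiK x w : w \in F x -> phi (psi x w) = w.
  rewrite -phiE => /memv_imgP[v vE ->].
  have lim : phi v \in limg (phi \o projv (E x))%VF.
    by apply/memv_imgP; exists v; rewrite ?memvf // comp_lfunE projv_id.
  by rewrite -[RHS](limg_lfunVK lim) !comp_lfunE.
have phi_in x v : v \in E x -> phi v \in F x by move=> vE; rewrite -phiE memv_img.
have psiK x v : v \in E x -> psi x (phi v) = v.
  by move=> vE; apply: (@phi_inj x) => //; rewrite phiK ?phi_in.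
have psi_reg D s : zopen D -> section_on (E := F) D s ->
    vregular_on D (fun x => psi x (s x)).
  move=> oD [rs sF] l; apply: regular_local => x0 Dx0.
  have [D1 [r [e [oD1 D1x0 re be]]]] := vb_loc E x0.
  pose c i x := coord [tuple e i x | i < r] i (psi x (s x)).
  have cE x : D1 x -> psi x (s x) = \sum_i c i x *: e i x.
    move=> /be b; rewrite [LHS](coord_basis b (psi_in _ _)).
    by apply: eq_bigr => i _; rewrite -tnth_nth tnth_mktuple.
  have oI := zopenI oD oD1.
  have [|||||N [oN Nx0 ND rc]] := @regular_frame_coef _ _ r
      (fun i x => phi (e i x)) s c x0 oI.
  - by [].
  - by move=> i; apply: vregular_map; apply: vregular_sub (re i) oI _ => y [].
  - by apply: vregular_sub rs oI _ => y [].
  - move=> k k0; have b := be x0 D1x0; have /freeP fe := basis_free b.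
    apply: fe; apply: (phiI x0).
      apply: rpred_sum => i _; apply: rpredZ; apply: (basis_mem b).
      by rewrite -tnth_nth mem_tnth.
    rewrite linear_sum -[RHS]k0; apply: eq_bigr => i _.
    by rewrite linearZ -tnth_nth tnth_mktuple.
  - move=> x [Dx D1x]; rewrite -[LHS](phiK x) ?sF // cE // linear_sum.
    by apply: eq_bigr => i _; rewrite linearZ.
  exists N; split=> // [y /ND[]//|].
  apply: (@regular_ext _ _ _ (fun x => \sum_i c i x * l (e i x))).
    apply: regular_sum => // i; apply: regularM; first exact: rc.
    by apply: regular_sub (re i l) oN _ => y /ND[].
  move=> x /ND[_ D1x]; rewrite cE // linear_sum; apply: eq_bigr => i _.
  by rewrite linearZ.
have phi_reg D s : zopen D -> section_on (E := E) D s ->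
    vregular_on D (fun x => phi (s x)).
  by move=> _ [rs _]; apply: vregular_map.
exists (@VBHom _ _ E F (fun=> phi) phi_in phi_reg).
exists (@VBHom _ _ F E psi (fun x w _ => psi_in x w) psi_reg).
by split; [exact: psiK | exact: phiK].
Qed.

(** The independent images squeeze the dimensions: p <= dim phi(E x) <= dim E x <= p, so [phi] is
    injective on [E x], and phi(E x) fills [F x], whose dimension is at most p. *)
Lemma vb_isomorphic_dim (E F : vbundle V) (phi : 'Hom(vb_amb E, vb_amb F)) p :
  (forall x v, v \in E x -> phi v \in F x) ->
  (forall x, (\dim (E x) <= p)%N) -> (forall x, (\dim (F x) <= p)%N) ->
  (forall x, exists w : 'I_p -> vb_amb E, (forall i, w i \in E x) /\
     forall c, \sum_i c i *: phi (w i) = 0 -> forall i, c i = 0) ->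
  vb_isomorphic E F.
Proof.
move=> phi_in dE dF indep.
have dimE x : (\dim (phi @: E x) = p)%N /\ (\dim (E x) = p)%N.
  have [w [wE fw]] := indep x.
  have fr : free [tuple phi (w i) | i < p].
    apply/freeP => c c0; apply: fw; rewrite -[RHS]c0; apply: eq_bigr => i _.
    by rewrite -tnth_nth tnth_mktuple.
  have le : (p <= \dim (phi @: E x))%N.
    move: fr; rewrite /free size_tuple => /eqP {1}<-; apply: dimvS.
    by apply/span_subvP => _ /tnthP[i ->]; rewrite tnth_mktuple memv_img.
  have le2 : (\dim (phi @: E x) <= \dim (E x))%N by rewrite -(limg_ker_dim phi) leq_addl.
  by split; apply/eqP; rewrite eqn_leq; rewrite ?dE ?(leq_trans le2) // (leq_trans le).
apply: (@vb_isomorphic_const _ _ phi) => [x v vE v0|x].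
  have := limg_ker_dim phi (E x); case: (dimE x) => -> ->.
  move/eqP; rewrite -[X in _ == X]add0n eqn_add2r dimv_eq0 => /eqP k0.
  by apply/eqP; rewrite -memv0 -k0 memv_cap vE memv_ker v0 eqxx.
apply/eqP; rewrite eqEdim (dimE x).1 dF andbT.
by apply/subvP => _ /memv_imgP[v vE ->]; apply: phi_in.
Qed.
End RegularFunctions.

(** * Linear maps on tensor powers *)

Section TensorMaps.
Variables (K : fieldType).

Lemma vbasis_frame (W : vectType K) (U : {vspace W}) :
  basis_of U [tuple (vbasis U)`_i | i < \dim U].
Proof.
suff -> : [tuple (vbasis U)`_i | i < \dim U] = vbasis U by exact: vbasisP.
by apply/eq_from_tnth => i; rewrite tnth_mktuple (tnth_nth 0).
Qed.

Lemma tens_sub_map n (W X : vectType K) (U : {vspace W}) (Y : {vspace X})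
    (L : {linear tens n W -> X}) :
  (forall v : 'I_n -> W, (forall i, v i \in U) -> L (pure v) \in Y) ->
  forall t, t \in tens_sub n U -> L t \in Y.
Proof.
move=> LY; suff /subvP H : (tens_sub n U <= linfun L @^-1: Y)%VS.
  by move=> t /H; rewrite -memv_preim lfunE.
apply/span_subvP => _ /mapP[f _ ->]; rewrite -memv_preim lfunE; apply: LY => i.
by rewrite vbasis_mem // mem_nth // size_tuple.
Qed.

Lemma galg_act_tens_sub n (W : vectType K) (U : {vspace W}) (a : 'S_n -> K) t :
  t \in tens_sub n U -> galg_act a t \in tens_sub n U.
Proof.
apply: (tens_sub_map (L := galg_act a)) => v vU /=; rewrite galg_act_pure.
by apply: rpred_sum => s _; apply: rpredZ; apply: pure_mem.
Qed.

Lemma galg_im_act n (W : vectType K) (U : {vspace W}) (a : 'S_n -> K) t :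
  t \in tens_sub n U -> galg_act a t \in galg_im a U.
Proof. by move=> tU; apply/memv_imgP; exists t; rewrite ?lfunE. Qed.

Lemma galg_im_sub n (W : vectType K) (U : {vspace W}) (a : 'S_n -> K) :
  (galg_im a U <= tens_sub n U)%VS.
Proof.
by apply/subvP => _ /memv_imgP[t tU ->]; rewrite lfunE galg_act_tens_sub.
Qed.

(** Contraction with the decomposable functional phi_1 (x) ... (x) phi_n, in coordinates. *)
Definition tens_form n (W : vectType K) (phi : 'I_n -> 'Hom(W, K^o))
    (t : tens n W) : K :=
  \sum_(g : {ffun 'I_n -> 'I_(\dim {:W})})
    (t g : K) * \prod_i phi i (vbasis {:W})`_(g i).

Fact tens_form_is_linear n W phi : linear (@tens_form n W phi : tens n W -> K^o).
Proof.
move=> c t t'; rewrite /tens_form scaler_sumr -big_split /=.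
by apply: eq_bigr => g _; rewrite !ffunE mulrDl; congr (_ + _); apply: esym (mulrA _ _ _).
Qed.

HB.instance Definition _ n W phi :=
  GRing.isLinear.Build K (tens n W) K^o *:%R (@tens_form n W phi : tens n W -> K^o)
    (@tens_form_is_linear n W phi).

Lemma tens_form_pure n (W : vectType K) (phi : 'I_n -> 'Hom(W, K^o)) v :
  tens_form phi (pure v) = \prod_i phi i (v i).
Proof.
transitivity (\prod_i \sum_k coord (vbasis {:W}) k (v i) *
                phi i (vbasis {:W})`_k).
  rewrite bigA_distr_bigA; apply: eq_bigr => g _.
  by rewrite ffunE -big_split.
apply: eq_bigr => i _; rewrite [v i in RHS]crd_expand [RHS]linear_sum.
by apply: eq_bigr => k _; rewrite linearZ.
Qed.

Definition tens_coord n (W : vectType K) g (t : tens n W) : K := t g.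

Fact tens_coord_is_linear n W g : linear (@tens_coord n W g : tens n W -> K^o).
Proof. by move=> c t t'; rewrite /tens_coord !ffunE. Qed.

HB.instance Definition _ n W g :=
  GRing.isLinear.Build K (tens n W) K^o *:%R (@tens_coord n W g : tens n W -> K^o)
    (@tens_coord_is_linear n W g).

Section Flatten.
Variables (W : vectType K) (n k N : nat).
Variables (pair : 'I_N -> 'I_n * 'I_k) (cell : 'I_n * 'I_k -> 'I_N).
Hypotheses (pairK : cancel pair cell) (cellK : cancel cell pair).

(** The identification of an n-th power of k-th tensor powers with an N-th one, factor [j] of block
    [i] going to position [cell (i, j)]. *)
Definition tens_flatten (t : tens n (tens k W)) : tens N W :=
  [ffun g : {ffun 'I_N -> 'I_(\dim {:W})} =>
     tens_form (fun i => linfun (@tens_coord k W [ffun j => g (cell (i, j))]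
                                 : tens k W -> K^o)) t].

Fact tens_flatten_is_linear : linear tens_flatten.
Proof. by move=> c t t'; apply/ffunP => g; rewrite !ffunE linearP. Qed.

HB.instance Definition _ :=
  GRing.isLinear.Build K (tens n (tens k W)) (tens N W) *:%R tens_flatten
    tens_flatten_is_linear.

Lemma tens_flatten_pure (v : 'I_n -> 'I_k -> W) :
  tens_flatten (pure (fun i => pure (v i))) =
  pure (fun b => v (pair b).1 (pair b).2).
Proof.
apply/ffunP => g; rewrite !ffunE tens_form_pure.
transitivity (\prod_i \prod_j coord (vbasis {:W}) (g (cell (i, j))) (v i j)).
  apply: eq_bigr => i _; rewrite lfunE /= /tens_coord ffunE.
  by apply: eq_bigr => j _; rewrite ffunE.
rewrite pair_bigA /= (reindex pair); last by exists cell => ? _.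
by apply: eq_bigr => b _; rewrite -surjective_pairing pairK.
Qed.

Lemma tens_flatten_mem (U : {vspace W}) (B : {vspace tens k W}) t :
  (B <= tens_sub k U)%VS -> t \in tens_sub n B ->
  tens_flatten t \in tens_sub N U.
Proof.
move=> BU; apply: (tens_sub_map (L := tens_flatten)) => v vB /=.
(* An element of [B] need not be a pure tensor, so each block is expanded in pure tensors of basis
   vectors before flattening. *)
have /fin_all_exists[c vE] i : exists c : {ffun 'I_k -> 'I_(\dim U)} -> K,
    v i = \sum_f c f *: pure (fun j => (vbasis U)`_(f j)).
  exact: (tens_subE (vbasis_frame U) (subvP BU _ (vB i))).
rewrite (eq_pure vE) pure_expand linear_sum; apply: rpred_sum => f _.
rewrite linearZ /=; apply: rpredZ.
rewrite (tens_flatten_pure (fun i j => (vbasis U)`_(f i j))).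
by apply: pure_mem => b; rewrite vbasis_mem // mem_nth // size_tuple.
Qed.
End Flatten.

End TensorMaps.

(** * Dimension bounds *)

Section Dimensions.
Variables (K : fieldType) (W : vectType K).

Lemma dim_galg_im_le n r (U : {vspace W}) (a : 'S_n -> K) (e : 'I_r -> W)
    (I : finType) (w : I -> tens n W) :
  basis_of U [tuple e i | i < r] ->
  (forall f : {ffun 'I_n -> 'I_r},
     galg_act a (pure (fun i => e (f i))) \in <<[seq w i | i : I]>>%VS) ->
  (\dim (galg_im a U) <= #|I|)%N.
Proof.
move=> eU aw; rewrite -(size_image w predT); apply: leq_trans (dim_span _).
apply: dimvS; apply/subvP => _ /memv_imgP[t /(tens_subE eU)[c ->] ->].
rewrite lfunE /= linear_sum; apply: rpred_sum => f _.
by rewrite linearZ /=; apply: rpredZ.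
Qed.

Lemma galg_act_antisymmetrizer n (p : 'S_n) (v : 'I_n -> W) :
  galg_act (@antisymmetrizer K n) (pure (fun i => v (p i))) =
  (-1) ^+ p *: galg_act (@antisymmetrizer K n) (pure v).
Proof.
rewrite !galg_act_pure scaler_sumr (reindex_inj (mulgI p)) /=.
apply: eq_bigr => s _; rewrite /antisymmetrizer odd_permM signr_addb scalerA.
by congr (_ *: _); apply: eq_pure => i; rewrite invMg permM permKV.
Qed.

Lemma galg_act_symmetrizer n (p : 'S_n) (v : 'I_n -> W) :
  galg_act (@symmetrizer K n) (pure (fun i => v (p i))) =
  galg_act (@symmetrizer K n) (pure v).
Proof.
rewrite !galg_act_pure (reindex_inj (mulgI p)) /=.
by apply: eq_bigr => s _; congr (_ *: _); apply: eq_pure => i; rewrite invMg permM permKV.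
Qed.

Lemma oppv_eq0 (X : vectType K) (u : X) : 2%:R != 0 :> K -> u = - u -> u = 0.
Proof.
move=> n2 /eqP; rewrite -subr_eq0 opprK -mulr2n -scaler_nat scaler_eq0.
by rewrite (negPf n2) => /eqP.
Qed.

(** A pure tensor of basis vectors with a repeated index is killed, and two with the same set of
    distinct indices have the same image up to sign. One representative per n-subset therefore
    spans. *)
Lemma dim_ext_le n (U : {vspace W}) : 2%:R != 0 :> K ->
  (\dim (galg_im (@antisymmetrizer K n) U) <= 'C(\dim U, n))%N.
Proof.
move=> n2; set r := \dim U; pose e (i : 'I_r) := (vbasis U)`_i.
pose T := {S : {set 'I_r} | #|S| == n}.
pose act f := galg_act (@antisymmetrizer K n) (pure (fun i => e (f i))).
pose good (S : {set 'I_r}) (f : {ffun 'I_n -> 'I_r}) :=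
  injectiveb f && ([set f i | i in 'I_n] == S).
pose w (S : T) := if [pick f | good (val S) f] is Some f then act f else 0.
have <- : #|{: T}| = 'C(r, n).
  rewrite card_sig -[r in RHS]card_ord -cardsT -cards_draws.
  by rewrite -[RHS]cardsE; apply: eq_card => S; rewrite !inE subsetT.
apply: (dim_galg_im_le (vbasis_frame U) (w := w)) => f; rewrite -/(act f).
have [/injectiveP fI|/injectivePn[i [j ij fij]]] := boolP (injectiveb f); last first.
  suff -> : act f = 0 by rewrite mem0v.
  apply: oppv_eq0 => //; have := galg_act_antisymmetrizer (tperm i j) (fun a => e (f a)).
  rewrite odd_tperm ij expr1 scaleN1r => <-; congr galg_act; apply: eq_pure => a.
  by case: tpermP => // ->; rewrite fij.
have cS : #|[set f i | i in 'I_n]| == n by rewrite card_imset // card_ord.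
pose S : T := exist (fun S : {set 'I_r} => #|S| == n) _ cS.
have : w S \in <<[seq w i | i : T]>>%VS by apply/memv_span/image_f.
rewrite /w; case: pickP => [g /andP[/injectiveP gI /eqP gS]|/(_ f)]; last first.
  by rewrite /good eqxx andbT; move/injectiveP: fI => ->.
have /fin_all_exists[h hE] i : exists j, g i = f j.
  have : g i \in val S by rewrite -gS imset_f.
  by rewrite /= => /imsetP[j _ ->]; exists j.
have hI : injective h by move=> i j hij; apply: gI; rewrite !hE hij.
have -> : act g = (-1) ^+ perm hI *: act f.
  rewrite -galg_act_antisymmetrizer; congr galg_act; apply: eq_pure => i.
  by rewrite permE hE.
by rewrite rpredZsign.
Qed.

(** Induction on the number of places where [f] and [g] differ. Equal numbers of zeros make the two
    kinds of disagreement equally frequent, so if one occurs both do, and swapping one place of each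
    kind brings [f] closer to [g]. *)
Lemma swap_invariant N (X : Type) (F : {ffun 'I_N -> 'I_2} -> X)
    (A : {set 'I_N}) :
  (forall (f : {ffun 'I_N -> 'I_2}) i j, i \in A -> j \in A ->
     F [ffun x => f (tperm i j x)] = F f) ->
  forall f g : {ffun 'I_N -> 'I_2}, (forall x, x \notin A -> f x = g x) ->
  #|[set x in A | f x == ord0]| = #|[set x in A | g x == ord0]| -> F f = F g.
Proof.
move=> FA f g; have [m] := ubnP #|[set x | f x != g x]|.
elim: m f => // m IH f lem fg cfg.
have [/eqP fgE|] := eqVneq [set x | f x != g x] set0.
  congr F; apply/ffunP => x; apply/eqP; move/eqP/setP/(_ x): fgE.
  by rewrite !inE => /negbFE.
pose D (f g : {ffun 'I_N -> 'I_2}) := [set x in A | (f x == ord0) && (g x != ord0)].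
have cD : #|D f g| = #|D g f|.
  pose B := [set x in A | (f x == ord0) && (g x == ord0)].
  apply/eqP; rewrite -(eqn_add2l #|B|); apply/eqP.
  rewrite -[LHS]cardsUI -[RHS]cardsUI.
  have -> : B :&: D f g = set0.
    by apply/setP => x; rewrite !inE; case: (g x == _); rewrite ?andbF.
  have -> : B :&: D g f = set0.
    by apply/setP => x; rewrite !inE; case: (f x == _); rewrite ?andbF.
  have -> : B :|: D f g = [set x in A | f x == ord0].
    apply/setP => x; rewrite !inE.
    by case: (x \in A); case: (f x == _); case: (g x == _).
  have -> : B :|: D g f = [set x in A | g x == ord0].
    apply/setP => x; rewrite !inE.
    by case: (x \in A); case: (f x == _); case: (g x == _).
  by rewrite cfg.
have o2 (a b : 'I_2) : a != b -> (a == ord0) = (b != ord0).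
  by case: a b => [[|[]]] // ? [[|[]]].
case/set0Pn => x; rewrite inE => fgx.
have xA : x \in A by apply: contraR fgx => /fg ->.
have [i [j [iD jD]]] : exists i j, i \in D f g /\ j \in D g f.
  have: (0 < #|D f g|)%N && (0 < #|D g f|)%N.
    have [fx|fx] := eqVneq (f x) ord0.
      rewrite -cD andbb; apply/card_gt0P; exists x.
      by rewrite inE xA fx eqxx -(o2 _ _ fgx) fx.
    rewrite cD andbb; apply/card_gt0P; exists x; rewrite inE xA fx andbT.
    by rewrite (o2 _ (f x)) // eq_sym.
  by case/andP => /card_gt0P[i ?] /card_gt0P[j ?]; exists i, j.
move: iD jD; rewrite !inE => /and3P[iA fi gi] /and3P[jA gj fj].
have [fi' gj'] := (eqP fi, eqP gj).
have fij : f i != g i by rewrite fi' eq_sym.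
have ij : i != j by apply: contraNneq gi => ->.
rewrite -(FA f i j iA jA); apply: IH => [|y yA|].
- rewrite -ltnS; apply: leq_trans lem; rewrite ltnS.
  apply: proper_card; apply/properP; split.
    apply/subsetP => y; rewrite !inE ffunE; case: tpermP => [-> _|-> _|//] //.
    by rewrite gj'.
  exists i; rewrite !inE // negbK ffunE tpermL; apply/eqP/val_inj.
  by move: fj gi; case: (f j) (g i) => [[|[|]]] // ? [[|[|]]].
- rewrite ffunE tpermD ?fg //; first by apply: contraNneq yA => <-.
  by apply: contraNneq yA => <-.
rewrite -cfg -(card_imset _ (@perm_inj _ (tperm i j))); apply: eq_card => y.
rewrite -[y](tpermK i j) (mem_imset _ _ perm_inj) !inE ffunE tpermK; congr (_ && _).
by case: tpermP => // ->; rewrite iA jA.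
Qed.

(** [P] selects normal forms, which all agree off [A]. By [swap_invariant] only the number of zeros
    on [A] matters, and it takes at most #|A| + 1 values. *)
Lemma dim_galg_im_count n (U : {vspace W}) (a : 'S_n -> K) (e : 'I_2 -> W)
    (A : {set 'I_n}) (P : pred {ffun 'I_n -> 'I_2}) :
  let act (f : {ffun 'I_n -> 'I_2}) := galg_act a (pure (fun i => e (f i))) in
  basis_of U [tuple e i | i < 2] ->
  (forall (f : {ffun 'I_n -> 'I_2}) i j, i \in A -> j \in A ->
     act [ffun x => f (tperm i j x)] = act f) ->
  (forall f g x, P f -> P g -> x \notin A -> f x = g x) ->
  (forall f, act f = 0 \/ exists g c, P g /\ act f = c *: act g) ->
  (\dim (galg_im a U) <= #|A|.+1)%N.
Proof.
move=> act eU actA PA actP.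
pose z (f : {ffun 'I_n -> 'I_2}) := #|[set x in A | f x == ord0]|.
pose w (j : 'I_#|A|.+1) := if [pick f | P f && (z f == j)] is Some f then act f else 0.
rewrite -[X in (_ <= X)%N]card_ord; apply: (dim_galg_im_le eU (w := w)) => f.
rewrite -/(act f); case: (actP f) => [->|[g [c [Pg ->]]]]; first exact: mem0v.
apply: rpredZ; have zg : (z g < #|A|.+1)%N.
  by rewrite ltnS; apply/subset_leq_card/subsetP => x; rewrite inE => /andP[].
have : w (Ordinal zg) \in <<[seq w i | i : 'I_#|A|.+1]>>%VS by apply/memv_span/image_f.
rewrite /w; case: pickP => [h /andP[Ph /eqP zh]|/(_ g)]; last by rewrite Pg eqxx.
suff -> : act h = act g by [].
by apply: (swap_invariant actA) => // x /(PA h g _ Ph Pg).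
Qed.

Lemma dim2_frame (U : {vspace W}) : \dim U = 2%N ->
  exists e : 'I_2 -> W, basis_of U [tuple e i | i < 2].
Proof.
by move=> <-; exists (fun i => (vbasis U)`_i); apply: vbasis_frame.
Qed.

Lemma dim_sym_le n (U : {vspace W}) : \dim U = 2%N ->
  (\dim (galg_im (@symmetrizer K n) U) <= n.+1)%N.
Proof.
move=> /dim2_frame[e eU]; rewrite -[n in X in (_ <= X)%N]card_ord -cardsT.
apply: (dim_galg_im_count (P := predT) eU) => [f i j _ _|f g x _ _|f].
- rewrite -(galg_act_symmetrizer (tperm i j) (fun a => e (f a))).
  by congr galg_act; apply: eq_pure => a; rewrite ffunE.
- by rewrite inE.
by right; exists f, 1; rewrite scale1r.
Qed.

End Dimensions.

(** * Young symmetrizers acting on pure tensors *)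

Section Young.
Variables (K : fieldType) (W : vectType K) (la : seq nat).
Local Notation N := (sumn la).
Local Notation act := (galg_act (W := W) (@young_symmetrizer K la)).

Lemma row_stabP (s : 'S_N) :
  reflect (forall i, reshape_index la (s i) = reshape_index la i)
          (s \in row_stab la).
Proof. by rewrite inE; apply: 'forall_eqP. Qed.

Lemma col_stabP (s : 'S_N) :
  reflect (forall i, reshape_offset la (s i) = reshape_offset la i)
          (s \in col_stab la).
Proof. by rewrite inE; apply: 'forall_eqP. Qed.

Lemma col_stabM s t : s \in col_stab la ->
  (s * t \in col_stab la)%g = (t \in col_stab la).
Proof.
move=> /col_stabP sC; apply/col_stabP/col_stabP => H i; last by rewrite permM H sC.
by rewrite -(permKV s i) -permM H sC.
Qed.

Lemma col_stabV s : (s^-1 \in col_stab la)%g = (s \in col_stab la).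
Proof.
by apply/col_stabP/col_stabP => H i; [rewrite -{2}(permK s i)|rewrite -{2}(permKV s i)];
   rewrite H.
Qed.

Lemma row_stabM s t : s \in row_stab la ->
  (s * t \in row_stab la)%g = (t \in row_stab la).
Proof.
move=> /row_stabP sC; apply/row_stabP/row_stabP => H i; last by rewrite permM H sC.
by rewrite -(permKV s i) -permM H sC.
Qed.

Lemma young_act_pure v : act (pure v) =
  \sum_(p in row_stab la) \sum_(q in col_stab la)
     (-1) ^+ q *: pure (fun i => v ((q^-1)%g ((p^-1)%g i))).
Proof.
rewrite galg_act_pure.
under eq_bigr => s _ do rewrite scaler_suml.
rewrite exchange_big; apply: eq_bigr => p _ /=.
under eq_bigr => s _ do rewrite scaler_suml.
rewrite (exchange_big_dep (mem (col_stab la))) /=; last by move=> s q _ /andP[].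
apply: eq_bigr => q qC; rewrite (big_pred1 (q * p)%g) => [|s].
  by congr (_ *: _); apply: eq_pure => i; rewrite invMg permM.
by rewrite qC /= eq_sym.
Qed.

(** The column antisymmetrizer acts first and absorbs [t] with its sign. *)
Lemma young_act_col t v : t \in col_stab la ->
  act (pure (fun i => v (t i))) = (-1) ^+ t *: act (pure v).
Proof.
move=> tC; rewrite !young_act_pure scaler_sumr; apply: eq_bigr => p _.
rewrite (reindex_inj (mulgI t)) /= scaler_sumr.
apply: eq_big => [q|q _]; first by rewrite col_stabM.
rewrite odd_permM signr_addb scalerA; congr (_ *: _); apply: eq_pure => i.
by rewrite invMg permM permKV.
Qed.

(** Commuting with all column permutations, [s] can be moved past the column antisymmetrizer and
    absorbed into the row sum. *)
Lemma young_act_row s v : s \in row_stab la ->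
  (forall q, q \in col_stab la -> commute q s) ->
  act (pure (fun i => v (s i))) = act (pure v).
Proof.
move=> sR sC; rewrite !young_act_pure (reindex_inj (mulgI s)) /=.
apply: eq_big => [p|p _]; first by rewrite row_stabM.
apply: eq_bigr => q /sC cqs; congr (_ *: _); apply: eq_pure => i.
have E : (s^-1 * q^-1 * s = q^-1)%g.
  by rewrite -mulgA -(commuteV (commute_sym cqs)) mulKg.
by rewrite invMg permM -[in RHS]E !permM.
Qed.
End Young.

(** * Two-row diagrams: boxes, columns and the dimension bound *)

Section TwoRows.
Variables (k l : nat).
Local Notation la := [:: k + l; l]%N.
Local Notation N := (sumn la).
Implicit Types i j : 'I_N.

(** The column of box [i], that is [reshape_offset] made explicit; the boxes below [k + l] form the
    first row. *)
Definition col2 i : nat := (if i < k + l then (i : nat) else i - (k + l))%N.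

Lemma ltn_cell i : (i < k + l + l)%N.
Proof. by have := ltn_ord i; rewrite [X in (_ < X)%N]/= addn0. Qed.

Lemma row_stab2P (s : 'S_N) :
  reflect (forall i, (s i < k + l)%N = (i < k + l)%N) (s \in row_stab la).
Proof.
have rE i : reshape_index la i = (k + l <= i)%N.
  have := ltn_cell i; rewrite /reshape_index; move: (val i) => {}i /= iN.
  rewrite !subn_eq0; case: ltnP => //= h.
  by suff -> : (i.+1 - (k + l) <= l)%N by []; lia.
by apply: (iffP (row_stabP _)) => H i; have := H i; rewrite !rE; lia.
Qed.

Lemma col_stab2P (s : 'S_N) :
  reflect (forall i, col2 (s i) = col2 i) (s \in col_stab la).
Proof.
have rE i : reshape_offset la i = col2 i.
  have := ltn_cell i; rewrite /reshape_offset /reshape_index /col2.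
  move: (val i) => {}i /= iN; rewrite !subn_eq0.
  case: ltnP => /= h; first by rewrite subn0.
  by have -> : (i.+1 - (k + l) <= l)%N by [lia]; rewrite /= addn0.
by apply: (iffP (col_stabP _)) => H i; have := H i; rewrite !rE.
Qed.

Lemma top_subproof (c : 'I_l) : (c < N)%N.
Proof. by case: c => c /=; lia. Qed.
Lemma bot_subproof (c : 'I_l) : (c + (k + l) < N)%N.
Proof. by case: c => c /=; lia. Qed.
Definition top_cell (c : 'I_l) : 'I_N := Ordinal (top_subproof c).
Definition bot_cell (c : 'I_l) : 'I_N := Ordinal (bot_subproof c).

Lemma col2_top c : col2 (top_cell c) = c.
Proof. by case: c => c cl; rewrite /col2 /=; case: ifP => //; lia. Qed.
Lemma col2_bot c : col2 (bot_cell c) = c.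
Proof. by case: c => c cl; rewrite /col2 /=; case: ifP => //; lia. Qed.

Lemma top_neq_bot c : top_cell c != bot_cell c.
Proof. by case: c => c cl; apply/eqP => /(congr1 val) /=; lia. Qed.

Lemma col2_eq i (c : 'I_l) : col2 i = c -> i = top_cell c \/ i = bot_cell c.
Proof.
case: c i => c cl [i iN]; rewrite /col2 /=; case: ifP => h e; [left|right];
  apply/val_inj => /=; move: iN e => /=; lia.
Qed.

Lemma col2_inj_tail i j : (l <= col2 i)%N -> col2 j = col2 i -> j = i.
Proof.
case: i j => i iN [j jN]; rewrite /col2 /= => h e; apply/val_inj => /=.
by move: iN jN h e => /=; case: ifP; case: ifP => /=; lia.
Qed.

Lemma col_stab_tperm c : tperm (top_cell c) (bot_cell c) \in col_stab la.
Proof.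
by apply/col_stab2P => i; case: tpermP => // ->; rewrite col2_top col2_bot.
Qed.

Lemma col_stab_tail q i : q \in col_stab la -> (l <= col2 i)%N -> q i = i.
Proof. by move=> /col_stab2P/(_ i) e h; apply: col2_inj_tail. Qed.

(** The boxes in columns of height 1; all of them lie in the first row. *)
Definition tail_cells : {set 'I_N} := [set i | l <= col2 i]%N.

Lemma card_tail_cells : #|tail_cells| = k.
Proof.
have inN (j : 'I_k) : (l + j < N)%N by case: j => j /=; lia.
rewrite -[RHS](card_ord k) -cardsT.
rewrite -(card_imset setT (f := fun j : 'I_k => Ordinal (inN j))).
  apply: eq_card => i; rewrite inE; apply/idP/imsetP => [h|[j _ ->]].
    have ik : (i - l < k)%N.
      by case: i h => i /= iN; rewrite /col2 /=; case: ifP; lia.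
    exists (Ordinal ik) => //; apply/val_inj => /=; move: h; rewrite /col2.
    by case: i ik => i /= iN; case: ifP; lia.
  by case: j => j jk; rewrite /col2 /=; case: ifP; lia.
by move=> i j /(congr1 val) /= /addnI/val_inj.
Qed.

Section Dim.
Variables (K : fieldType) (W : vectType K) (U : {vspace W}).

(** A column of height 2 with equal entries kills the tensor; any other is brought to 0 above 1 at
    the cost of a sign. Tail boxes are fixed by all column permutations, so their entries may be
    permuted freely, and only the number of zeros among the k of them remains. *)
Lemma dim_schur2_le : 2%:R != 0 :> K -> \dim U = 2%N ->
  (\dim (galg_im (@young_symmetrizer K la) U) <= k.+1)%N.
Proof.
move=> n2 /dim2_frame[e eU]; rewrite -[k in X in (_ <= X)%N]card_tail_cells.
pose act (f : {ffun 'I_N -> 'I_2}) :=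
  galg_act (@young_symmetrizer K la) (pure (fun i => e (f i))).
pose o1 : 'I_2 := lift ord0 ord0.
have o1P (a : 'I_2) : a != ord0 -> a = o1.
  by case: a => [[|[|]]] // ? _; apply/val_inj.
pose P (f : {ffun 'I_N -> 'I_2}) := [forall c : 'I_l,
  (f (top_cell c) == ord0) && (f (bot_cell c) == o1)].
have act_swap (f : {ffun 'I_N -> 'I_2}) c :
    act [ffun x => f (tperm (top_cell c) (bot_cell c) x)] = - act f.
  have := young_act_col (fun a => e (f a)) (col_stab_tperm c).
  rewrite odd_tperm top_neq_bot expr1 scaleN1r => <-.
  by congr galg_act; apply: eq_pure => a; rewrite ffunE.
apply: (dim_galg_im_count (P := P) eU) => [f i j iA jA|f g x Pf Pg xA|f].
- pose s := tperm i j; have sC q : q \in col_stab la -> commute q s.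
    move=> qC; have qi : q i = i by apply: col_stab_tail => //; move: iA; rewrite inE.
    have qj : q j = j by apply: col_stab_tail => //; move: jA; rewrite inE.
    apply/permP => x; rewrite !permM /s; case: (tpermP i j x) => [->|->|/eqP xi /eqP xj].
    + by rewrite qi qj tpermL.
    + by rewrite qi qj tpermR.
    by rewrite tpermD // eq_sym -?[X in _ != X]qi -?[X in _ != X]qj (inj_eq perm_inj).
  rewrite -(young_act_row (fun a => e (f a)) _ sC).
    by congr galg_act; apply: eq_pure => a; rewrite ffunE.
  apply/row_stab2P => x; rewrite /s; move: iA jA; rewrite !inE /col2.
  by case: tpermP => // -> ; case: ifP; case: ifP; move: (ltn_cell i) (ltn_cell j); lia.
- have xl : (col2 x < l)%N by rewrite ltnNge; move: xA; rewrite inE.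
  have /andP[/eqP f0 /eqP f1] := forallP Pf (Ordinal xl).
  have /andP[/eqP g0 /eqP g1] := forallP Pg (Ordinal xl).
  by case: (@col2_eq x (Ordinal xl)) => // ->; rewrite ?f0 ?g0 ?f1 ?g1.
change (act f = 0 \/ exists g c, P g /\ act f = c *: act g).
(* Induction on the number of height 2 columns whose top entry is not 0; swapping such a column
   lowers it by one. *)
have [m] := ubnP #|[set c : 'I_l | f (top_cell c) != ord0]|.
elim: m f => // m IH f lem.
have [/existsP[c /eqP fc]|] := boolP [exists c, f (top_cell c) == f (bot_cell c)].
  left; apply: oppv_eq0 => //; rewrite -(act_swap f c); congr act; apply/ffunP => x.
  by rewrite ffunE; case: tpermP => // ->; rewrite fc.
rewrite negb_exists => /forallP ftb.
have [/eqP f0|/set0Pn[c]] := eqVneq [set c : 'I_l | f (top_cell c) != ord0] set0.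
  right; exists f, 1; split; last by rewrite scale1r.
  apply/forallP => c; move/eqP/setP/(_ c): f0; rewrite !inE => /negbFE f0.
  by rewrite f0 /=; apply/eqP/o1P; rewrite -(eqP f0) eq_sym.
rewrite inE => fc; pose g : {ffun 'I_N -> 'I_2} :=
  [ffun x => f (tperm (top_cell c) (bot_cell c) x)].
have fE : act f = - act g by rewrite act_swap opprK.
rewrite fE; have [|->|[h [a [Ph ->]]]] := IH g.
- rewrite -ltnS; apply: leq_trans lem; rewrite ltnS; apply: proper_card.
  apply/properP; split.
    apply/subsetP => c'; rewrite !inE ffunE; have [->//|cc'] := eqVneq c' c.
    rewrite tpermD //; apply: contraNneq cc' => /(congr1 col2);
      by rewrite ?col2_top ?col2_bot => /val_inj ->.
  exists c; rewrite !inE // negbK ffunE tpermL.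
  by apply/negPn/negP => /o1P h1; move: (ftb c); rewrite h1 (o1P _ fc) eqxx.
- by left; rewrite oppr0.
by right; exists h, (- a); rewrite scaleNr.
Qed.
End Dim.
End TwoRows.

(** * Evaluating a two-row Young symmetrizer *)

Section ColumnSum.
Variables (K : fieldType) (k l : nat).
Local Notation la := [:: k + l; l]%N.
Local Notation N := (sumn la).
Local Notation top := (@top_cell k l).
Local Notation bot := (@bot_cell k l).
Local Notation col := (@col2 k l).

(** The column permutations moving only boxes of the first [m] columns: a filtration that permits
    induction on the columns. *)
Let cstab m : {set 'S_N} :=
  [set q in col_stab la | [forall i, (m <= col i)%N ==> (q i == i)]].

Let cstabP m (q : 'S_N) :
  reflect ((forall i, col (q i) = col i) /\ (forall i, (m <= col i)%N -> q i = i))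
          (q \in cstab m).
Proof.
rewrite inE; apply: (iffP andP) => [[/col_stab2P cq /'forall_implyP qi]|[cq qi]].
  by split=> [//|i /qi/eqP].
by split; [apply/col_stab2P | apply/'forall_implyP => i /qi ->].
Qed.

Let cstab0 : cstab 0 = [set 1%g].
Proof.
apply/setP => q; rewrite in_set1; apply/cstabP/eqP => [[_ q1]|->].
  by apply/permP => i; rewrite perm1 q1.
by split=> i; rewrite perm1.
Qed.

(** Two cosets of [cstab c], told apart by whether the top box of column [c] is fixed. *)
Let sumS (c : 'I_l) (G : 'S_N -> K) :
  \sum_(q in cstab c.+1) G q = \sum_(q in cstab c) G q +
    \sum_(q in cstab c) G (q * tperm (top c) (bot c))%g.
Proof.
set t := tperm _ _; have tc i : col (t i) = col i.
  by rewrite /t; case: tpermP => // ->; rewrite col2_top col2_bot.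
have fix_m q : q \in cstab c.+1 -> q (top c) = top c -> q \in cstab c.
  move=> /cstabP[cq qi] qt; apply/cstabP; split=> // i; rewrite leq_eqVlt.
  case/orP => [/eqP ci|/qi//]; case: (@col2_eq k l i c (esym ci)) => [->//|ib].
  case: (@col2_eq k l (q i) c) => [|it|->//]; first by rewrite cq.
  by rewrite it -qt (perm_inj (etrans it (esym qt))).
have subS q : q \in cstab c -> q \in cstab c.+1.
  by move=> /cstabP[cq qi]; apply/cstabP; split=> [//|i /ltnW/qi].
have tS q : q \in cstab c.+1 -> (q * t)%g \in cstab c.+1.
  move=> /cstabP[cq qi]; apply/cstabP; split=> i; rewrite permM ?tc ?cq // => ci.
  rewrite qi // /t tpermD //; apply: contraTneq ci => <-;
    by rewrite ?col2_top ?col2_bot ltnn.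
have qc q : q \in cstab c -> q (top c) = top c.
  by move=> /cstabP[_ ->]; rewrite ?col2_top.
rewrite (bigID (fun q : 'S_N => q (top c) == top c)) /=; congr (_ + _).
  apply: eq_bigl => q; apply/andP/idP => [[qS /eqP]|q0]; first exact: fix_m.
  by rewrite subS ?qc.
rewrite (reindex_inj (mulIg t)) /=; apply: eq_bigl => q.
apply/andP/idP => [[qS qt]|q0].
  have tt : (q * t * t = q)%g by rewrite -mulgA tperm2 mulg1.
  have q1S : q \in cstab c.+1 by rewrite -tt tS.
  apply: fix_m => //; have [cq _] := cstabP _ _ q1S.
  case: (@col2_eq k l (q (top c)) c) => [|//|qb]; first by rewrite cq col2_top.
  by move: qt; rewrite permM qb /t tpermR eqxx.
by rewrite tS ?subS // permM qc // /t tpermL eq_sym top_neq_bot.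
Qed.

Let prod_split (c : 'I_l) (X : 'I_N -> K) :
  \prod_(i | (c <= col i)%N) X i =
  X (top c) * X (bot c) * \prod_(i | (c < col i)%N) X i.
Proof.
rewrite (bigD1 (top c)) ?col2_top //= (bigD1 (bot c)) /=; last first.
  by rewrite col2_bot leqnn eq_sym top_neq_bot.
rewrite mulrA; congr (_ * _); apply: eq_bigl => i; rewrite -andbA.
apply/and3P/idP => [[ci it ib]|ci].
  rewrite ltn_neqAle ci andbT; apply: contraNneq ib => ci'.
  by case: (@col2_eq k l i c (esym ci')) => [it'|->//]; rewrite it' eqxx in it.
split; [exact: ltnW| |]; apply: contraTneq ci => ->;
  by rewrite ?col2_top ?col2_bot ltnn.
Qed.

(** This is the Leibniz expansion of a block diagonal determinant, with a 2 x 2 block for each of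
    the first [m] columns of height 2 and blocks of size 1 elsewhere. *)
Let cstab_sum m (F : 'I_N -> 'I_N -> K) : (m <= l)%N ->
  \sum_(q in cstab m) (-1) ^+ q * \prod_i F i (q i) =
  (\prod_(c < l | (c < m)%N) (F (top c) (top c) * F (bot c) (bot c)
                            - F (top c) (bot c) * F (bot c) (top c))) *
  \prod_(i | (m <= col i)%N) F i i.
Proof.
elim: m F => [|m IH] F ml.
  rewrite cstab0 big_set1 odd_perm1 mul1r [X in _ = X * _]big_pred0 ?mul1r //.
  by apply: eq_big => // i _; rewrite perm1.
pose c : 'I_l := Ordinal ml; pose t := tperm (top c) (bot c).
rewrite -[m.+1]/(c.+1) sumS.
(* The second coset contributes, with opposite sign, the sum for [F] twisted by [t]; the twist
   affects only column [c], where it gives the antidiagonal product of the minor. *)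
under [X in _ + X]eq_bigr => q _.
  rewrite odd_permM odd_tperm top_neq_bot addbT signrN mulNr.
  under eq_bigr => i _ do rewrite permM.
  over.
rewrite sumrN (IH F (ltnW ml)) (IH (fun i j => F i (t j)) (ltnW ml)).
rewrite -[m]/(val c) !prod_split /t tpermL tpermR.
set D := \prod_(c' < l | (c' < c)%N) _; set D' := \prod_(c' < l | (c' < c)%N) _.
set T := \prod_(i | _) _; set T' := \prod_(i | _) _.
have td i : col i != c -> tperm (top c) (bot c) i = i.
  by move=> ic; rewrite tpermD //; apply: contraNneq ic => <-;
    rewrite ?col2_top ?col2_bot.
have -> : D' = D.
  apply: eq_bigr => c' c'c; rewrite !td ?col2_top ?col2_bot //;
  by rewrite neq_ltn c'c.
have -> : T' = T.
  by apply: eq_bigr => i ci; rewrite td // neq_ltn ci orbT.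
rewrite (bigD1 c) //=.
have -> : \prod_(i < l | (i < m.+1)%N && (i != c))
   (F (top i) (top i) * F (bot i) (bot i) - F (top i) (bot i) * F (bot i) (top i)) = D.
  by apply: eq_bigl => i; rewrite -(inj_eq val_inj) /= ltnS ltn_neqAle andbC.
by ring.
Qed.

Lemma col_stab_sum (F : 'I_N -> 'I_N -> K) :
  \sum_(q in col_stab la) (-1) ^+ q * \prod_i F i (q i) =
  (\prod_(c < l) (F (top c) (top c) * F (bot c) (bot c)
                - F (top c) (bot c) * F (bot c) (top c))) *
  \prod_(i in tail_cells k l) F i i.
Proof.
have -> : col_stab la = cstab l.
  apply/setP => q; apply/idP/cstabP => [qC|[cq _]]; last exact/col_stab2P.
  by split=> [|i]; [apply/col_stab2P | apply: col_stab_tail].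
rewrite cstab_sum //; congr (_ * _); apply: eq_bigl => i; rewrite ?ltn_ord //.
by rewrite inE.
Qed.

(* Each column of height 2 contributes the 2 x 2 minor of (alpha, beta) on its *)
(* two entries; the forms being constant along rows, the row stabilizer only   *)
(* contributes its order.                                                      *)
Lemma tens_form_young (W : vectType K) (alpha beta : 'Hom(W, K^o)) (v : 'I_N -> W) :
  tens_form (fun i => if (i < k + l)%N then alpha else beta)
    (galg_act (@young_symmetrizer K la) (pure v)) =
  #|row_stab la|%:R *
  ((\prod_(c < l) (alpha (v (top c)) * beta (v (bot c))
                   - alpha (v (bot c)) * beta (v (top c)))) *
   \prod_(i in tail_cells k l) alpha (v i)).
Proof.
set th := fun i => _; rewrite young_act_pure linear_sum.
rewrite mulr_natl -sumr_const; apply: eq_bigr => p pR.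
have -> : (\prod_(c < l) (alpha (v (top c)) * beta (v (bot c))
                   - alpha (v (bot c)) * beta (v (top c)))) *
    \prod_(i in tail_cells k l) alpha (v i) =
   \sum_(q in col_stab la) (-1) ^+ q * \prod_i th i (v (q i)).
  rewrite (col_stab_sum (fun i j => th i (v j))); congr (_ * _).
    apply: eq_bigr => c _; rewrite /th /= [(c + _ < _)%N]ltnNge leq_addl /=.
    have -> : (c < k + l)%N by case: c => c /=; lia.
    by congr (_ - _); rewrite mulrC.
  apply: eq_bigr => i; rewrite inE /th /col2; case: ifP => // h1 h2.
  by have := ltn_cell i; lia.
rewrite linear_sum (reindex_inj invg_inj).
apply: eq_big => [q|q _]; first by rewrite col_stabV.
transitivity ((-1) ^+ (q^-1)%g *
    tens_form th (pure (fun i => v ((q^-1^-1)%g ((p^-1)%g i))))).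
  exact: linearZ.
rewrite odd_permV tens_form_pure; congr (_ * _).
rewrite (reindex_inj (@perm_inj _ p)); apply: eq_bigr => i _.
have /row_stab2P pi := pR.
by rewrite invgK permK /th pi.
Qed.

Lemma row_stab_card_gt0 : (0 < #|row_stab la|)%N.
Proof.
by apply/card_gt0P; exists 1%g; apply/row_stab2P => i; rewrite perm1.
Qed.
End ColumnSum.

(** * Transvectants *)

Section Discriminant.
Variable (K : fieldType).

Definition vdm n (b : 'I_n -> K) : K :=
  \prod_(i < n) \prod_(j < n | (i < j)%N) (b j - b i).

Lemma vdm_perm n (b : 'I_n -> K) (s : 'S_n) :
  vdm (fun i => b (s i)) = (-1) ^+ s * vdm b.
Proof.
have vE (c : 'I_n -> K) : vdm c = \det (Vandermonde n (\row_i c i)).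
  rewrite det_Vandermonde; apply: eq_bigr => i _; apply: eq_bigr => j _.
  by rewrite !mxE.
rewrite !vE; set A := Vandermonde _ _; set B := Vandermonde _ _.
have -> : A = col_perm s B by apply/matrixP => i j; rewrite !mxE.
by rewrite col_permE det_mulmx det_perm odd_permV mulrC.
Qed.

Lemma vdm_neq0 n (b : 'I_n -> K) : injective b -> vdm b != 0.
Proof.
move=> bI; apply/prodf_neq0 => i _; apply/prodf_neq0 => j ij.
by rewrite subr_eq0 (inj_eq bI) neq_ltn ij orbT.
Qed.
End Discriminant.

Section Transvectant.
Variables (K : fieldType) (V : vectType K) (n d k l : nat).
Local Notation la := [:: k + l; l]%N.
Local Notation N := (sumn la).
Variables (pair : 'I_N -> 'I_n * 'I_d) (cell : 'I_n * 'I_d -> 'I_N).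
Hypotheses (pairK : cancel pair cell) (cellK : cancel cell pair).

(* The n blocks of d tensor factors are distributed over the boxes of la by   *)
(* [cell]; a column of height 2 meeting two blocks contracts them by the      *)
(* symplectic form, as in a classical transvectant.                           *)
Definition transvectant : 'Hom(tens n (tens d V), tens N V) :=
  (linfun (galg_act (@young_symmetrizer K la)) \o
   linfun (tens_flatten cell : tens n (tens d V) -> tens N V))%VF.

Lemma transvectant_mem (U : {vspace V}) t :
  t \in galg_im (@antisymmetrizer K n) (galg_im (@symmetrizer K d) U) ->
  transvectant t \in galg_im (@young_symmetrizer K la) U.
Proof.
move=> /(subvP (galg_im_sub _ _)) tB; rewrite comp_lfunE !lfunE /=.
apply/galg_im_act/(tens_flatten_mem pairK cellK _ tB); exact: galg_im_sub.
Qed.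

(** The wedge of the d-th powers of u_(b_i) = x + b_i y, that is of n points on the rational normal
    curve of degree d. *)
Definition ext_powers (x y : V) (b : 'I_n -> K) : tens n (tens d V) :=
  galg_act (@antisymmetrizer K n)
    (pure (fun i => pure (fun _ : 'I_d => x + b i *: y))).

(** Symmetrizing a d-th power multiplies it by d!, so dividing by d! exhibits it in the image of the
    symmetrizer. *)
Lemma ext_powers_mem (U : {vspace V}) x y b : d`!%:R != 0 :> K ->
  x \in U -> y \in U ->
  ext_powers x y b \in
    galg_im (@antisymmetrizer K n) (galg_im (@symmetrizer K d) U).
Proof.
move=> d0 xU yU; apply/galg_im_act/pure_mem => i.
set v := fun _ => _.
have -> : pure v = d`!%:R^-1 *: galg_act (@symmetrizer K d) (pure v).
  rewrite galg_act_pure.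
  under eq_bigr => s _ do rewrite /symmetrizer scale1r.
  rewrite (eq_bigr (fun=> pure v)) => [|s _]; last exact: eq_pure.
  rewrite sumr_const card_Sn -scaler_nat scalerA mulVf ?scale1r //.
apply/rpredZ/galg_im_act/pure_mem => j; by rewrite rpredD ?rpredZ.
Qed.

(** In the fillings used below, [m] is the number of height 2 columns shared by each pair of blocks
    and [e] the number of tail boxes of each block. *)
Variables (m e : nat).
Hypothesis m_odd : odd m.
Hypothesis columns : forall b : 'I_n -> K,
  \prod_(c < l) (b (pair (bot_cell k c)).1 - b (pair (top_cell k c)).1) =
  vdm b ^+ m.
Hypothesis tail : forall b : 'I_n -> K,
  \prod_(i in tail_cells k l) b (pair i).1 = \prod_i b i ^+ e.

(** Here alpha(u_s) = s - z and beta(u_s) = -1, so a column with u_s above u_t contributes the minor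
    t - s, free of z, and a tail box contributes s - z. As [m] is odd, permuting the points changes
    [vdm b ^+ m] by the sign of the permutation, which cancels that of the antisymmetrizer: all n!
    terms agree. *)
Lemma transvectant_ext_powers (alpha beta : 'Hom(V, K^o)) (x y : V) (z : K) b :
  alpha x = - z -> alpha y = 1 -> beta x = -1 -> beta y = 0 ->
  tens_form (fun i : 'I_N => if (i < k + l)%N then alpha else beta)
    (transvectant (ext_powers x y b)) =
  #|row_stab la|%:R * n`!%:R * (vdm b ^+ m * \prod_i (b i - z) ^+ e).
Proof.
move=> ax ay bx bY; pose u s := x + s *: y.
have au s : alpha (u s) = s - z.
  by rewrite linearD linearZ /= ax ay [LHS]addrC; congr (_ - _); apply: mulr1.
have bu s : beta (u s) = -1 by rewrite linearD linearZ /= bx bY scaler0 addr0.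
set th := fun i => _.
have step (s : 'S_n) :
    tens_form th (transvectant (pure (fun i => pure (fun _ : 'I_d => u (b (s i)))))) =
    (-1) ^+ s * (#|row_stab la|%:R * (vdm b ^+ m * \prod_i (b i - z) ^+ e)).
  rewrite comp_lfunE !lfunE /=.
  rewrite (tens_flatten_pure pairK cellK (fun i _ => u (b (s i)))) tens_form_young.
  rewrite [RHS]mulrCA; congr (_ * _); rewrite [RHS]mulrA; congr (_ * _).
    transitivity (vdm (fun i => b (s i)) ^+ m).
      rewrite -columns; apply: eq_bigr => c _; rewrite !au !bu.
      by ring.
    by rewrite vdm_perm exprMn exprAC -[(-1) ^+ m]signr_odd m_odd.
  under eq_bigr => i _ do rewrite au.
  rewrite (tail (fun i => b (s i) - z)).
  by rewrite [RHS](reindex_inj (@perm_inj _ s)).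
rewrite /ext_powers galg_act_pure !linear_sum.
transitivity (\sum_(s : 'S_n) #|row_stab la|%:R * (vdm b ^+ m * \prod_i (b i - z) ^+ e)).
  apply: eq_bigr => s _; rewrite !linearZ.
  transitivity ((-1) ^+ s * ((-1) ^+ (s^-1)%g *
    (#|row_stab la|%:R * (vdm b ^+ m * \prod_i (b i - z) ^+ e)))).
    by rewrite -step.
  by rewrite odd_permV mulrA -signr_addb addbb mul1r.
rewrite sumr_const -[LHS]mulr_natl [LHS]mulrCA [LHS]mulrA; congr (_ * _%:R * _).
by rewrite -[RHS]card_Sn; apply: eq_card.
Qed.

Lemma transvectant_relation (I : finType) (c : I -> K) (b : I -> 'I_n -> K)
    (alpha beta : K -> 'Hom(V, K^o)) x y :
  [pchar K] =i pred0 ->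
  (forall z, [/\ alpha z x = - z, alpha z y = 1, beta z x = -1 & beta z y = 0]) ->
  \sum_i c i *: transvectant (ext_powers x y (b i)) = 0 ->
  forall z, \sum_i c i * (vdm (b i) ^+ m * \prod_j (b i j - z) ^+ e) = 0.
Proof.
move=> /pcharf0P char0 ab c0 z; have [ax ay bx bY] := ab z.
pose th (i : 'I_N) := if (i < k + l)%N then alpha z else beta z.
have M0 : #|row_stab la|%:R * n`!%:R != 0 :> K.
  by rewrite -natrM char0 -lt0n muln_gt0 fact_gt0 row_stab_card_gt0.
apply: (mulfI M0); rewrite mulr0 -[RHS](linear0 (tens_form th)) -c0 linear_sum mulr_sumr.
apply: eq_bigr => i _; rewrite mulrCA.
transitivity (c i * tens_form th (transvectant (ext_powers x y (b i)))).
  by rewrite (transvectant_ext_powers (z := z)).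
by rewrite linearZ.
Qed.
End Transvectant.

(** * Fillings of the diagram by blocks *)

Section Fillings.
Variables (K : fieldType) (n d k l : nat) (cells : seq nat).
Local Notation la := [:: k + l; l]%N.
Local Notation N := (sumn la).
Let block i := (index i cells %/ d)%N.

(* [cells] lists the boxes of the diagram, block after block. *)
Lemma filling : perm_eq cells (iota 0 N) -> N = (n.+1 * d)%N -> (0 < d)%N ->
  exists (pair : 'I_N -> 'I_n.+1 * 'I_d) (cell : 'I_n.+1 * 'I_d -> 'I_N),
  [/\ cancel pair cell, cancel cell pair,
      forall b : 'I_n.+1 -> K,
        \prod_(c < l) (b (pair (bot_cell k c)).1 - b (pair (top_cell k c)).1) =
        \prod_(c <- iota 0 l)
           (b (inord (block (c + (k + l)))) - b (inord (block c)))
    & forall b : 'I_n.+1 -> K, \prod_(i in tail_cells k l) b (pair i).1 =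
        \prod_(i <- iota l k) b (inord (block i))].
Proof.
move=> cP Nnd d0.
have szc : size cells = (n.+1 * d)%N by rewrite (perm_size cP) size_iota.
have idx (b : 'I_N) : (index (val b) cells < n.+1 * d)%N.
  by rewrite -szc index_mem (perm_mem cP) mem_iota add0n ltn_ord.
have p1 (b : 'I_N) : (block (val b) < n.+1)%N by rewrite ltn_divLR.
have p2 (b : 'I_N) : (index (val b) cells %% d < d)%N by rewrite ltn_mod.
have pos (p : 'I_n.+1 * 'I_d) : (p.1 * d + p.2 < size cells)%N.
  rewrite szc; case: p => -[i ilt] [j jlt] /=.
  by apply: (@leq_trans (i.+1 * d)); rewrite ?leq_mul2r ?ilt ?orbT //
    mulSn addnC ltn_add2r.
have cl (p : 'I_n.+1 * 'I_d) : (nth 0%N cells (p.1 * d + p.2) < N)%N.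
  by have := mem_nth 0%N (pos p); rewrite (perm_mem cP) mem_iota.
pose pair b : 'I_n.+1 * 'I_d := (Ordinal (p1 b), Ordinal (p2 b)).
exists pair, (fun p => Ordinal (cl p)).
have pairE b : (pair b).1 = inord (block (val b)) by apply/val_inj/esym/inordK/p1.
split=> [b|p|b|b].
- apply/val_inj => /=; rewrite /block -divn_eq nth_index //.
  by rewrite (perm_mem cP) mem_iota add0n ltn_ord.
- have uc : uniq cells by rewrite (perm_uniq cP) iota_uniq.
  case: p (pos p) => i j lt; congr (_, _); apply/val_inj => /=;
    rewrite /block index_uniq //=.
    by rewrite divnMDl // divn_small ?addn0.
  by rewrite modnMDl modn_small.
- rewrite (_ : iota 0 l = index_iota 0 l) ?big_mkord; last by rewrite /index_iota subn0.
  by apply: eq_bigr => c _; rewrite !pairE.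
under eq_bigr => i _ do rewrite pairE.
rewrite (_ : iota l k = index_iota l (k + l)); last by rewrite /index_iota addnK.
have kN : (k + l <= N)%N by rewrite leq_addr.
rewrite (big_nat_widen _ _ _ _ _ kN) big_geq_mkord; apply: eq_bigl => i.
rewrite inE /col2.
by have := ltn_cell i; case: ifP => /=; lia.
Qed.
End Fillings.

(** Big operators over ordinals become ones over explicit lists, which unfold by computation so that
    [ring] can finish. *)
Lemma big_ord_inord (R : Type) (idx : R) (op : R -> R -> R) n (P : pred nat)
    (F : 'I_n.+1 -> R) :
  \big[op/idx]_(i < n.+1 | P i) F i = \big[op/idx]_(i <- iota 0 n.+1 | P i) F (inord i).
Proof.
rewrite -[iota 0 n.+1]/(index_iota 0 n.+1) big_mkord.
by apply: eq_bigr => i _; rewrite inord_val.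
Qed.

Lemma vdm_inord (K : fieldType) n (b : 'I_n.+1 -> K) :
  vdm b = \prod_(i <- iota 0 n.+1) \prod_(j <- iota 0 n.+1 | (i < j)%N)
            (b (inord j) - b (inord i)).
Proof.
rewrite /vdm (big_ord_inord _ _ xpredT); apply: eq_big_seq => i.
rewrite mem_iota => /= ilt.
by rewrite (big_ord_inord _ _ (fun j => inord i < j)%N) inordK.
Qed.

(** * The three isomorphisms *)

Section Isomorphisms.
Variables (K : fieldType) (V : vectType K).
Hypothesis char0 : [pchar K] =i pred0.
Local Notation S := (taut_bundle V).

Let natr0 n : (n%:R == 0 :> K) = (n == 0%N).
Proof. by have /pcharf0P-> := char0. Qed.

Lemma natr_inj : injective (fun n => n%:R : K).
Proof.
have w p q : (p <= q)%N -> p%:R = q%:R :> K -> p = q.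
  move=> pq /esym/eqP; rewrite -subr_eq0 -natrB // natr0 subn_eq0 => qp.
  by apply/eqP; rewrite eqn_leq pq.
by move=> p q pq; case: (leqP p q) => [|/ltnW] /w; [apply|move=> ->].
Qed.

(** On [U], the form [alpha z] vanishes exactly on the line of x + z y, so contracting with it
    evaluates a binary form at z. *)
Lemma dual_frame (U : {vspace V}) : \dim U = 2%N ->
  exists (x y : V) (alpha beta : K -> 'Hom(V, K^o)), [/\ x \in U, y \in U &
    forall z, [/\ alpha z x = - z, alpha z y = 1, beta z x = -1 & beta z y = 0]].
Proof.
move=> /dim2_frame[e eU]; pose X := [tuple e i | i < 2].
pose o1 : 'I_2 := lift ord0 ord0.
pose a i : 'Hom(V, K^o) := linfun (coord X i : V -> K^o).
have aE i j : a i (e j) = (i == j)%:R.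
  by rewrite lfunE /= -[e j](tnth_mktuple e) (tnth_nth 0)
    coord_free ?(basis_free eU) // eq_sym.
have eM i : e i \in U.
  by apply: (basis_mem eU); apply/tnthP; exists i; rewrite tnth_mktuple.
exists (e ord0), (e o1), (fun z => - z *: a ord0 + a o1), (fun=> - a ord0).
split=> // z; split;
  rewrite ?add_lfunE ?opp_lfunE ?scale_lfunE !aE /= ?scaler0 ?add0r ?oppr0 //.
by rewrite addr0; apply: mulr1.
Qed.

Lemma dim_ext_sym n x :
  (\dim (ext_bundle n (sym_bundle 3 S) x) <= 'C(4, n))%N.
Proof.
have n2 : 2%:R != 0 :> K by rewrite natr0.
apply: leq_trans (@dim_ext_le K _ n (sym_bundle 3 S x) n2) _.
by apply: leq_bin2l; apply: dim_sym_le; apply/eqP/(valP x).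
Qed.

Lemma dim_schur k l x :
  (\dim (schur_bundle [:: k + l; l]%N S x) <= k.+1)%N.
Proof. by apply: dim_schur2_le; [rewrite natr0 | apply/eqP/(valP x)]. Qed.

(** The case of a single Schur power: what is left to supply is a filling with the right column and
    tail products, and test points whose polynomials in z are independent. *)
Lemma ext_sym_iso_schur n k l (cells : seq nat) m e (b : 'I_k.+1 -> 'I_n.+1 -> K) :
  perm_eq cells (iota 0 (sumn [:: k + l; l]%N)) ->
  sumn [:: k + l; l]%N = (n.+1 * 3)%N -> odd m ->
  (forall b : 'I_n.+1 -> K, \prod_(c <- iota 0 l)
      (b (inord (index (c + (k + l)) cells %/ 3)) - b (inord (index c cells %/ 3)))
     = vdm b ^+ m) ->
  (forall b : 'I_n.+1 -> K, \prod_(i <- iota l k) b (inord (index i cells %/ 3))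
     = \prod_i b i ^+ e) ->
  'C(4, n.+1) = k.+1 ->
  (forall c : 'I_k.+1 -> K,
     (forall z, \sum_i c i * (vdm (b i) ^+ m * \prod_j (b i j - z) ^+ e) = 0) ->
     forall i, c i = 0) ->
  vb_isomorphic (ext_bundle n.+1 (sym_bundle 3 S)) (schur_bundle [:: k + l; l]%N S).
Proof.
move=> cP cN m_odd cols tl binE indep.
have [pair [cell [pairK cellK pc pt]]] := filling K cP cN isT.
pose phi := transvectant V cell.
apply: (@vb_isomorphic_dim K V (ext_bundle n.+1 (sym_bundle 3 S))
          (schur_bundle [:: k + l; l]%N S) phi k.+1) => [x t|x|x|x].
- exact: transvectant_mem.
- by rewrite -binE; apply: dim_ext_sym.
- exact: dim_schur.
have [u [v [alpha [beta [uU vU ab]]]]] := dual_frame (eqP (valP x)).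
exists (fun i => ext_powers 3 u v (b i)); split=> [i|c c0].
  by apply: ext_powers_mem; rewrite ?natr0.
apply: indep; apply: (transvectant_relation pairK cellK m_odd _ _ char0 ab c0) => b'.
  by rewrite pc cols.
by rewrite pt tl.
Qed.

Lemma ext3_iso :
  vb_isomorphic (ext_bundle 3 (sym_bundle 3 S)) (schur_bundle [:: 6; 3] S).
Proof.
(* [b i] enumerates {0, 1, 2, 3} without i. *)
pose b (i : 'I_4) (j : 'I_3) : K := (lift i j : nat)%:R.
(* By blocks the rows read 0 0 1 0 1 2 and 1 2 2: each pair of blocks shares one column, and each
   block has one tail box. *)
apply: (@ext_sym_iso_schur 2 3 3 [:: 0; 1; 3; 2; 4; 6; 5; 7; 8]%N 1 1 b) => //.
- by move=> a; rewrite vdm_inord unlock /=; ring.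
- by move=> a; rewrite (big_ord_inord _ _ xpredT) unlock /=; ring.
(* Lagrange interpolation: at z = i every term whose subset contains i vanishes, leaving only the
   subset that omits i. *)
move=> c c0 i; have := c0 i%:R; rewrite (bigD1 i) //= [X in _ + X]big1 ?addr0 => [|j ji].
  move/eqP; rewrite mulf_eq0 => /orP[/eqP //|].
  rewrite expr1 mulf_eq0 (negPf (vdm_neq0 _)) /=; last first.
    by move=> p q /natr_inj/val_inj/lift_inj.
  move/prodf_eq0 => [p _]; rewrite expr1 subr_eq0 => /eqP/natr_inj/val_inj/eqP.
  by rewrite eq_sym (negPf (neq_lift _ _)).
have [p ip] : exists p, lift j p = i.
  by case: (unliftP j i) => [p ->|ij]; [exists p|rewrite ij eqxx in ji].
suff -> : \prod_q (b j q - i%:R) ^+ 1 = 0 by rewrite !mulr0.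
by rewrite (bigD1 p) //= /b ip subrr expr1 mul0r.
Qed.

Lemma ext4_iso :
  vb_isomorphic (ext_bundle 4 (sym_bundle 3 S)) (schur_bundle [:: 6; 6] S).
Proof.
pose b (i : 'I_1) (j : 'I_4) : K := j%:R.
(* By blocks the rows read 0 0 0 1 1 2 and 1 2 3 2 3 3: the columns are the six pairs of blocks. *)
apply: (@ext_sym_iso_schur 3 0 6 [:: 0; 1; 2; 3; 4; 6; 5; 7; 9; 8; 10; 11]%N 1 0 b) => //.
- by move=> a; rewrite vdm_inord unlock /=; ring.
- by move=> a; rewrite big_nil big1.
move=> c c0 i; have := c0 0; rewrite big_ord1 (ord1 i) => /eqP.
rewrite mulf_eq0 => /orP[/eqP //|].
rewrite [X in _ * X]big1 // mulr1 expr1 (negPf (vdm_neq0 _)) //.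
by move=> p q /natr_inj/val_inj.
Qed.
Lemma ext2_iso :
  vb_isomorphic (ext_bundle 2 (sym_bundle 3 S))
    (dsum_bundle (schur_bundle [:: 5; 1] S) (schur_bundle [:: 3; 3] S)).
Proof.
pose tab := [:: [:: 0; 1]; [:: 0; 2]; [:: 0; 3]; [:: 1; 2]; [:: 1; 3]; [:: 2; 3]]%N.
pose b (i : 'I_6) (j : 'I_2) : K := (nth 0%N (nth [::] tab i) j)%:R.
(* For (5,1) the blocks read 0 0 0 1 1 over 1, so m = 1 and e = 2; for (3,3) they read 0 0 0 over 1
   1 1, so m = 3 and e = 0. *)
have [pair [cell [pairK cellK pc pt]]] :=
  @filling K 1 3 4 1 (iota 0 6) isT erefl isT.
have [pair' [cell' [pairK' cellK' pc' pt']]] :=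
  @filling K 1 3 0 3 (iota 0 6) isT erefl isT.
pose phi := transvectant V cell; pose phi' := transvectant V cell'.
pose E := ext_bundle 2 (sym_bundle 3 S).
pose F := schur_bundle [:: 5; 1] S; pose F' := schur_bundle [:: 3; 3] S.
pose inl := linfun (@pair_inl K (vb_amb F) (vb_amb F')).
pose inr := linfun (@pair_inr K (vb_amb F) (vb_amb F')).
pose psi := (inl \o phi)%VF + (inr \o phi')%VF.
have psiE t : psi t = (phi t, phi' t).
  rewrite add_lfunE !comp_lfunE !(lfunE (@pair_inl _ _ _)) !(lfunE (@pair_inr _ _ _)).
  by congr (_, _); rewrite /= ?addr0 ?add0r.
apply: (@vb_isomorphic_dim K V E (dsum_bundle F F') psi 6) => [x t tE|x|x|x].
- rewrite /= dsum_fibE psiE; apply/andP; split.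
    exact: (transvectant_mem pairK cellK tE).
  exact: (transvectant_mem pairK' cellK' tE).
- exact: dim_ext_sym.
- have sub : (dsum_bundle F F' x <= inl @: F x + inr @: F' x)%VS.
    apply/subvP => -[t t']; rewrite dsum_fibE => /andP[/= tF tF'].
    have -> : (t, t') = inl t + inr t'.
      by rewrite !lfunE; congr (_, _); rewrite /= ?addr0 ?add0r.
    by rewrite memv_add ?memv_img.
  apply: leq_trans (dimvS sub) _.
  rewrite (leq_trans (leq_of_leqif (dimv_add_leqif _ _))) //.
  have le (W W' : vectType K) (f : 'Hom(W, W')) G : (\dim (f @: G) <= \dim G)%N.
    by rewrite -(limg_ker_dim f) leq_addl.
  apply: leq_trans (leq_add (le _ _ _ _) (le _ _ _ _)) _.
  exact: (leq_add (dim_schur 4 1 x) (dim_schur 0 3 x)).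
have [u [v [alpha [beta [uU vU ab]]]]] := dual_frame (eqP (valP x)).
exists (fun i => ext_powers 3 u v (b i)); split=> [i|c c0].
  by apply: ext_powers_mem; rewrite ?natr0.
have c1 : \sum_i c i *: phi (ext_powers 3 u v (b i)) = 0.
  move/(congr1 fst): c0; rewrite raddf_sum /= => c0; rewrite -[RHS]c0.
  by apply: eq_bigr => i _; rewrite psiE.
have c2 : \sum_i c i *: phi' (ext_powers 3 u v (b i)) = 0.
  move/(congr1 snd): c0; rewrite raddf_sum /= => c0; rewrite -[RHS]c0.
  by apply: eq_bigr => i _; rewrite psiE.
have {c1} r1 z : \sum_i c i * (vdm (b i) ^+ 1 * \prod_j (b i j - z) ^+ 2) = 0.
  apply: (transvectant_relation pairK cellK _ _ _ char0 ab c1) => // a.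
    by rewrite pc vdm_inord unlock /=; ring.
  by rewrite pt (big_ord_inord _ _ xpredT) unlock /=; ring.
have {c2} r2 z : \sum_i c i * (vdm (b i) ^+ 3 * \prod_j (b i j - z) ^+ 0) = 0.
  apply: (transvectant_relation pairK' cellK' _ _ _ char0 ab c2) => // a.
    by rewrite pc' vdm_inord unlock /=; ring.
  by rewrite pt' (big_ord_inord _ _ xpredT) unlock /=; ring.
pose C j := c (inord j); pose p i j : K := (nth 0%N (nth [::] tab i) j)%:R.
have relE m e z :
    \sum_i c i * (vdm (b i) ^+ m * \prod_j (b i j - z) ^+ e) =
    \sum_(i <- iota 0 6) C i *
      ((p i 1%N - p i 0%N) ^+ m * ((p i 0%N - z) ^+ e * (p i 1%N - z) ^+ e)).
  rewrite (big_ord_inord _ _ xpredT); apply: eq_big_seq => i; rewrite mem_iota => /= i6.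
  have bE j : (j < 2)%N -> b (inord i) (inord j) = p i j.
    by move=> j2; rewrite /b !inordK.
  rewrite vdm_inord (big_ord_inord _ _ xpredT) unlock /= !bE //.
  by rewrite !mulr1.
have {r1} e1 z := etrans (esym (relE 1%N 2%N z)) (r1 z).
have {r2} e2 := etrans (esym (relE 3%N 0%N 0)) (r2 0).
(* The (5,1) relation has degree at most 4 in z, so five values of z capture it; the (3,3) relation
   is free of z and supplies the sixth equation for the six coefficients. *)
move: (e1 0) (e1 1) (e1 2%:R) (e1 3%:R) (e1 4%:R) e2; rewrite /p unlock /=.
set L0 := (X in X = 0 -> _); set L1 := (X in _ -> X = 0 -> _).
set L2 := (X in _ -> _ -> X = 0 -> _); set L3 := (X in _ -> _ -> _ -> X = 0 -> _).
set L4 := (X in _ -> _ -> _ -> _ -> X = 0 -> _).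
set L5 := (X in _ -> _ -> _ -> _ -> _ -> X = 0 -> _).
move=> l0 l1 l2 l3 l4 l5.
(* The coefficients below are the rows of the inverse of this 6 x 6 system. *)
have solve D j a0 a1 a2 a3 a4 a5 : (0 < D)%N ->
    D%:R * C j = a0 * L0 + a1 * L1 + a2 * L2 + a3 * L3 + a4 * L4 + a5 * L5 -> C j = 0.
  rewrite l0 l1 l2 l3 l4 l5 !mulr0 !addr0 lt0n => D0 /eqP.
  by rewrite mulf_eq0 natr0 (negPf D0) => /eqP.
have C0 : C 0%N = 0.
  by apply: (@solve 1728%N _ 5 (-32) 114 64 (-7) (-24)) => //;
    rewrite /L0 /L1 /L2 /L3 /L4 /L5; ring.
have C1 : C 1%N = 0.
  by apply: (@solve 108%N _ (-1) 7 (-30) 7 (-1) 12) => //;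
    rewrite /L0 /L1 /L2 /L3 /L4 /L5; ring.
have C2 : C 2%N = 0.
  by apply: (@solve 1728%N _ (-7) 64 114 (-32) 5 (-24)) => //;
    rewrite /L0 /L1 /L2 /L3 /L4 /L5; ring.
have C3 : C 3%N = 0.
  by apply: (@solve 64%N _ 1 (-8) 42 (-24) 5 (-24)) => //;
    rewrite /L0 /L1 /L2 /L3 /L4 /L5; ring.
have C4 : C 4%N = 0.
  by apply: (@solve 108%N _ 2 (-20) (-3) 4 (-1) 12) => //;
    rewrite /L0 /L1 /L2 /L3 /L4 /L5; ring.
have C5 : C 5%N = 0.
  by apply: (@solve 1728%N _ 29 184 (-102) 40 (-7) (-24)) => //;
    rewrite /L0 /L1 /L2 /L3 /L4 /L5; ring.
move=> i; rewrite -(inord_val i).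
by case: i => -[|[|[|[|[|[|]]]]]].
Qed.
End Isomorphisms.

Local Close Scope ring_scope.

Theorem lemma2p1 (R : realType) (d : nat) (V : vectType R[i])
    (hV : \dim {:V} = (d + 2)%N) :
  let S := taut_bundle V in
  [/\ vb_isomorphic (ext_bundle 2 (sym_bundle 3 S))
        (dsum_bundle (schur_bundle [:: 5; 1] S) (schur_bundle [:: 3; 3] S)),
      vb_isomorphic (ext_bundle 3 (sym_bundle 3 S)) (schur_bundle [:: 6; 3] S)
    & vb_isomorphic (ext_bundle 4 (sym_bundle 3 S)) (schur_bundle [:: 6; 6] S)].
Proof.
have char0 := Num.Theory.pchar_num R[i].
by split; [apply: ext2_iso | apply: ext3_iso | apply: ext4_iso].
Qed.
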